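(* For every $\eta>0$ there exists a positive integer $N_0$ such that for every integer $N>N_0$ the following holds. Let $\alpha_1>\alpha_2>0$ be reals with $\alpha_1+\alpha_2=1$. Let $G[X,Y]$ be a balanced bipartite graph on $2(N-1)$ vertices (so $|X|=|Y|=N-1$) with minimum degree $\delta(G)\geq(\frac{3}{4}+3\eta)(N-1)$. Then for every red-blue coloring of the edges of $G$, either for every even integer $\ell$ with $4\le \ell\le (2-3\eta^2)\alpha_1N$ there is a red cycle of length $\ell$, or for every even integer $\ell$ with $4\le \ell\le (2-3\eta^2)\alpha_2N$ there is a blue cycle of length $\ell$.
   Context: A red (resp. blue) cycle is a cycle in $G$ all of whose edges are colored red (resp. blue). *)

(* Defs.v *)
From mathcomp Require Import all_boot all_order all_algebra.
From mathcomp Require Export reals.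
Set Implicit Arguments. Unset Strict Implicit. Unset Printing Implicit Defensive.

Definition simple_graph (T : finType) (e : rel T) :=
  symmetric e /\ irreflexive e.

Definition bipartite_with (T : finType) (e : rel T) (X Y : {set T}) :=
  [/\ [disjoint X & Y], X :|: Y = setT &
      forall u v, e u v -> (u \in X) && (v \in Y) || (u \in Y) && (v \in X)].

Definition deg (T : finType) (e : rel T) (v : T) : nat := #|[set u | e v u]|.

(* A red-blue edge coloring: col u v = true means red, false means blue;
   it must be symmetric on edges. *)
Definition edge_coloring (T : finType) (e : rel T) (col : T -> T -> bool) :=
  forall u v, e u v -> col u v = col v u.

Definition colored_cycle (T : finType) (e : rel T) (col : T -> T -> bool)
  (b : bool) (l : nat) : Prop :=
  exists v : 'I_l -> T, injective v /\
    forall i : 'I_l, forall j : 'I_l, val j = (val i).+1 %% l ->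
      e (v i) (v j) /\ col (v i) (v j) = b.

(* Main.v *)
Require Import Defs.
From mathcomp Require Import all_boot all_order all_algebra.
From mathcomp Require Import reals boolp zify ring lra.
Set Implicit Arguments. Unset Strict Implicit. Unset Printing Implicit Defensive.

(** Regularity method.  Szemeredi's lemma, applied to the red and the blue graph at once,
    gives equal clusters, almost all pairs of which are regular in both colours.  In the
    reduced graph every (good) cluster is joined, in red or in blue, to more than 3/4 of
    the m clusters on the other side.

    Such a reduced graph has, for 2q <= m, a red matching of size m - q inside one red
    component or a blue matching of size q inside one blue component.  Indeed, a union U of
    red components with at least half of one side and at most half of the other leaves a
    bipartite blue graph with both sides at least m / 2, which is enough.  Otherwise either
    the red components fall into three groups, each with less than half of both sides, and
    then blue is connected; or one red component D contains more than half of both sides,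
    and by Koenig's theorem a red cover of D of size < m - q exhibits the blue matching.

    A connected matching of p clusters gives closed walks of every even length up to about
    2ps that visit each cluster of size s fewer than s times, with a small margin.  A closed
    walk of that kind is embedded greedily as a cycle with one vertex for each visit, which
    yields the short and the long even cycles alike. *)

(** * Matchings and covers *)

(** König's theorem, by induction on the number of vertices. A cover is a pair of sets, [C] for the
    side [A] and [D] for the side [B]; the sides may overlap, since only endpoints on the same side
    have to differ. *)
Lemma konig (V : finType) (rho : rel V) (A B : {set V}) (q : nat) :
  (forall C D : {set V},
     (forall a b, a \in A -> b \in B -> rho a b -> (a \in C) || (b \in D)) ->
     q <= #|C| + #|D|) ->
  exists M : seq (V * V),
    [/\ size M = q, uniq (unzip1 M), uniq (unzip2 M) &
        {in M, forall uv, [/\ uv.1 \in A, uv.2 \in B & rho uv.1 uv.2]}].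
Proof.
have [n] := ubnP (#|A| + #|B|).
elim: n A B q => // n IH A B [|q] ltn cov; first by exists [::].
have [a [b [aA bB ab]]] : exists a b, [/\ a \in A, b \in B & rho a b].
  apply: contrapT => nex.
  have : q < #|@set0 V| + #|@set0 V|.
    by apply: cov => a b aA bB ab; case: nex; exists a, b.
  by rewrite cards0.
have cA := cardsD1 a A; have cB := cardsD1 b B; rewrite aA bB in cA cB.
(* If deleting the edge ab leaves no cover of size < q, add ab to a matching of the rest; *)
(* otherwise there is a minimum cover (C, D) containing both a and b, which splits the    *)
(* graph into the smaller pieces (C, B \ D) and (A \ C, D).                               *)
have [cov'|] := pselect (forall C D : {set V},
  (forall x y, x \in A :\ a -> y \in B :\ b -> rho x y -> (x \in C) || (y \in D)) ->
  q <= #|C| + #|D|).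
  have [|M [sM u1 u2 HM]] := IH _ _ _ _ cov'; first by lia.
  exists ((a, b) :: M); split => /=; first by rewrite sM.
  - rewrite u1 andbT; apply/mapP => -[uv /HM[+ _ _] E].
    by rewrite -E !inE eqxx.
  - rewrite u2 andbT; apply/mapP => -[uv /HM[_ + _] E].
    by rewrite -E !inE eqxx.
  - move=> uv; rewrite inE => /predU1P[-> //|/HM[]].
    by rewrite !inE => /andP[_ ->] /andP[_ ->].
move=> /existsNP[C'] /existsNP[D'] /not_implyP[cov' /negP]; rewrite -ltnNge => lt'.
pose C := a |: (C' :&: A); pose D := b |: (D' :&: B).
have leC : #|C| <= #|C'|.+1.
  by rewrite cardsU1; have := subset_leq_card (subsetIl C' A); case: (_ \notin _); lia.
have leD : #|D| <= #|D'|.+1.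
  by rewrite cardsU1; have := subset_leq_card (subsetIl D' B); case: (_ \notin _); lia.
have CA : C \subset A by rewrite subUset sub1set aA subsetIr.
have DB : D \subset B by rewrite subUset sub1set bB subsetIr.
have covCD x y : x \in A -> y \in B -> rho x y -> (x \in C) || (y \in D).
  move=> xA yB xy; rewrite !inE xA yB !andbT.
  have [//|xa] := eqVneq x a; have [|yb] := eqVneq y b; first by rewrite orbT.
  by apply: cov'; rewrite // !inE ?xa ?yb.
have eqq : #|C| + #|D| = q.+1 by have := cov C D covCD; lia.
have aC : a \in C by rewrite !inE eqxx.
have bD : b \in D by rewrite !inE eqxx.
have cAC := cardsD A C; have cBD := cardsD B D.
rewrite (setIidPr CA) in cAC; rewrite (setIidPr DB) in cBD.
have sC := subset_leq_card CA; have sD := subset_leq_card DB.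
have pC : 0 < #|C| by apply/card_gt0P; exists a.
have pD : 0 < #|D| by apply/card_gt0P; exists b.
have [||M1 [s1 u11 u12 H1]] := IH C (B :\: D) #|C|; first by lia.
  move=> C1 D1 cov1; have [leU _] := leq_card_setU D D1.
  suff : q < #|C1| + #|D :|: D1| by lia.
  apply: cov => x y xA yB xy; rewrite inE.
  have [|yD] := boolP (y \in D); first by rewrite orbT.
  have := covCD _ _ xA yB xy; rewrite (negPf yD) orbF => xC.
  by apply: cov1; rewrite // inE yD.
have [||M2 [s2 u21 u22 H2]] := IH (A :\: C) D #|D|; first by lia.
  move=> C1 D1 cov1; have [leU _] := leq_card_setU C C1.
  suff : q < #|C :|: C1| + #|D1| by lia.
  apply: cov => x y xA yB xy; rewrite inE.
  have [//|xC] := boolP (x \in C).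
  have := covCD _ _ xA yB xy; rewrite (negPf xC) /= => yD.
  by apply: cov1; rewrite // inE xC.
exists (M1 ++ M2); split.
- by rewrite size_cat s1 s2.
- rewrite /unzip1 map_cat cat_uniq u11 u21 andbT /=; apply/hasPn => x /mapP[uv /H2[+ _ _] ->].
  rewrite inE => /andP[nC _]; apply/mapP => -[uv' /H1[+ _ _] E].
  by rewrite -E (negPf nC).
- rewrite /unzip2 map_cat cat_uniq u12 u22 andbT /=; apply/hasPn => x /mapP[uv /H2[_ + _] ->].
  move=> D2; apply/mapP => -[uv' /H1[_ + _] E].
  by rewrite -E inE D2.
- move=> uv; rewrite mem_cat => /orP[/H1[]|/H2[]].
    by move=> /(subsetP CA) ? /setDP[].
  by move=> /setDP[? _] /(subsetP DB).
Qed.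

(** * Connected matchings in two-coloured bipartite graphs *)

(** All [2 * q] endpoints are distinct. Connecting the first endpoints suffices, since each second
    endpoint is adjacent to its partner. *)
Definition connected_matching (V : finType) (rho : rel V) (q : nat) :=
  exists M : seq (V * V),
    [/\ size M = q, uniq (unzip1 M ++ unzip2 M),
        {in M, forall uv, rho uv.1 uv.2} &
        {in M &, forall uv uv', connect rho uv.1 uv'.1}].

(** König's theorem is applied to a subgraph [ga] of [rho] chosen so that its edges are known to be
    connected, while the connections themselves may use every edge of [rho]. *)
Lemma connected_matching_of_covers (V : finType) (A B : {set V}) (rho ga : rel V) q :
  [disjoint A & B] ->
  (forall a b, a \in A -> b \in B -> ga a b -> rho a b) ->
  (forall a b a' b', a \in A -> b \in B -> ga a b -> a' \in A -> b' \in B ->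
     ga a' b' -> connect rho a a') ->
  (forall C D : {set V},
     (forall a b, a \in A -> b \in B -> ga a b -> (a \in C) || (b \in D)) ->
     q <= #|C| + #|D|) ->
  connected_matching rho q.
Proof.
move=> dAB sub conn /konig[M [sM u1 u2 HM]]; exists M; split => //.
- rewrite cat_uniq u1 u2 andbT /=; apply/hasPn => x /mapP[uv /HM[_ xB _] ->].
  apply/mapP => -[uv' /HM[xA _ _] E]; rewrite E in xB.
  by rewrite (disjointFr dAB xA) in xB.
- by move=> uv /HM[? ? ?]; apply: sub.
- by move=> uv uv' /HM[? ? ?] /HM[? ? ?]; apply: (conn _ uv.2 _ uv'.2).
Qed.

Lemma cardD_le (V : finType) (S C : {set V}) : #|S| <= #|S :\: C| + #|C|.
Proof. by have := cardsID C S; have := subset_leq_card (subsetIr S C); lia. Qed.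

Section Core.
Variables (V : finType) (A B : {set V}) (rho beta : rel V) (m : nat).
Hypothesis dAB : [disjoint A & B].
Hypothesis rho_sym : symmetric rho.
Hypothesis beta_sym : symmetric beta.
Hypothesis cA : #|A| = m.
Hypothesis cB : #|B| = m.

Let adj a b := rho a b || beta a b.

Hypothesis missA : forall a, a \in A -> 4 * #|[set b in B | ~~ adj a b]| < m.
Hypothesis missB : forall b, b \in B -> 4 * #|[set a in A | ~~ adj a b]| < m.

Lemma nonadjA (a : V) (S : {set V}) : a \in A -> S \subset B ->
  (forall b, b \in S -> ~~ adj a b) -> 4 * #|S| < m.
Proof.
move=> aA SB H; apply: leq_ltn_trans (missA aA); rewrite leq_mul2l /=.
by apply/subset_leq_card/subsetP => b bS; rewrite !inE (subsetP SB) ?H.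
Qed.

Lemma nonadjB (b : V) (S : {set V}) : b \in B -> S \subset A ->
  (forall a, a \in S -> ~~ adj a b) -> 4 * #|S| < m.
Proof.
move=> bB SA H; apply: leq_ltn_trans (missB bB); rewrite leq_mul2l /=.
by apply/subset_leq_card/subsetP => a aS; rewrite !inE (subsetP SA) ?H.
Qed.

(** Each of the two vertices misses fewer than m / 4 vertices, so together they cannot miss a set of
    size m / 2. *)
Lemma common_nbrA (a a' : V) (S : {set V}) : a \in A -> a' \in A -> S \subset B ->
  m <= 2 * #|S| -> exists b, [/\ b \in S, adj a b & adj a' b].
Proof.
move=> aA a'A SB leS; apply: contrapT => nex.
have h1 := @nonadjA a (S :&: [set b | ~~ adj a b]) aA.
have h2 := @nonadjA a' (S :&: [set b | ~~ adj a' b]) a'A.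
have : 4 * #|S :&: [set b | ~~ adj a b]| < m.
  by apply: h1; [rewrite (subset_trans (subsetIl _ _))|move=> b; rewrite !inE => /andP[]].
have : 4 * #|S :&: [set b | ~~ adj a' b]| < m.
  by apply: h2; [rewrite (subset_trans (subsetIl _ _))|move=> b; rewrite !inE => /andP[]].
suff : #|S| <= #|S :&: [set b | ~~ adj a b]| + #|S :&: [set b | ~~ adj a' b]| by lia.
have [leU _] := leq_card_setU (S :&: [set b | ~~ adj a b]) (S :&: [set b | ~~ adj a' b]).
apply: leq_trans leU; apply/subset_leq_card/subsetP => b bS; rewrite !inE bS /= -negb_and.
by apply/negP => /andP[? ?]; apply: nex; exists b.
Qed.

Lemma common_nbrB (b b' : V) (S : {set V}) : b \in B -> b' \in B -> S \subset A ->
  m <= 2 * #|S| -> exists a, [/\ a \in S, adj a b & adj a b'].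
Proof.
move=> bB b'B SA leS; apply: contrapT => nex.
have : 4 * #|S :&: [set a | ~~ adj a b]| < m.
  by apply: (nonadjB bB); [rewrite (subset_trans (subsetIl _ _))|move=> a; rewrite !inE => /andP[]].
have : 4 * #|S :&: [set a | ~~ adj a b']| < m.
  by apply: (nonadjB b'B); [rewrite (subset_trans (subsetIl _ _))|move=> a; rewrite !inE => /andP[]].
suff : #|S| <= #|S :&: [set a | ~~ adj a b]| + #|S :&: [set a | ~~ adj a b']| by lia.
have [leU _] := leq_card_setU (S :&: [set a | ~~ adj a b]) (S :&: [set a | ~~ adj a b']).
apply: leq_trans leU; apply/subset_leq_card/subsetP => a aS; rewrite !inE aS /= -negb_and.
by apply/negP => /andP[? ?]; apply: nex; exists a.
Qed.

Lemma nbrA (a : V) (S : {set V}) : a \in A -> S \subset B ->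
  m <= 4 * #|S| -> exists2 b, b \in S & adj a b.
Proof.
move=> aA SB; rewrite leqNgt => /negP leS; apply: contrapT => nex; apply: leS.
by apply: (nonadjA aA) => // b bS; apply/negP => ab; apply: nex; exists b.
Qed.

Lemma nbrB (b : V) (S : {set V}) : b \in B -> S \subset A ->
  m <= 4 * #|S| -> exists2 a, a \in S & adj a b.
Proof.
move=> bB SA; rewrite leqNgt => /negP leS; apply: contrapT => nex; apply: leS.
by apply: (nonadjB bB) => // a aS; apply/negP => ab; apply: nex; exists a.
Qed.

(** These are the unions of [rho]-components. An edge of [adj] with exactly one end in such a set
    must be a [beta]-edge. *)
Definition color_closed (U : {set V}) := forall u v, rho u v -> (u \in U) = (v \in U).

Lemma color_closedC U : color_closed U -> color_closed (~: U).
Proof. by move=> clU u v /clU E; rewrite !inE E. Qed.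

Lemma color_closedU U W : color_closed U -> color_closed W -> color_closed (U :|: W).
Proof. by move=> clU clW u v uv; rewrite !inE (clU _ _ uv) (clW _ _ uv). Qed.

Lemma color_closed_component v : color_closed [set w | connect rho v w].
Proof.
move=> u w uw; rewrite !inE; apply/idP/idP => /connect_trans; apply.
  exact: connect1.
by apply: connect1; rewrite rho_sym.
Qed.

Lemma beta_cross U a b : color_closed U -> adj a b -> (a \in U) != (b \in U) -> beta a b.
Proof. by move=> clU /orP[/clU->|//]; rewrite eqxx. Qed.

Lemma connect_via a b a' : beta a b -> beta a' b -> connect beta a a'.
Proof.
by move=> ab a'b; apply: (@connect_trans _ _ b); apply: connect1; rewrite // beta_sym.
Qed.

(** Edges between [A :&: U] and [B :\: U] are all [beta]-edges, and both sets have at least m / 2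
    vertices, so common neighbours connect them. If a cover had fewer than q vertices, some a and b
    would survive on the two sides; each leaves fewer than m / 4 survivors opposite, so fewer than m
    / 2 + q <= m vertices in all, although the two sets have at least m. *)
Lemma matching_mixed U q : 2 * q <= m -> color_closed U ->
  m <= 2 * #|A :&: U| -> 2 * #|B :&: U| <= m -> connected_matching beta q.
Proof.
move=> q2 clU hA hB; have cBU := cardsID U B.
have hB' : m <= 2 * #|B :\: U| by lia.
have [->|q0] := posnP q; first by exists [::].
apply: (@connected_matching_of_covers _ A B _
          (fun a b => [&& adj a b, a \in U & b \notin U])) => //.
- move=> a b _ _ /and3P[ab aU bU]; apply: (beta_cross clU) => //.
  by rewrite aU (negPf bU).
- move=> a b a' b' aA _ /and3P[_ aU _] a'A _ /and3P[_ a'U _].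
  have [b0 [+ ab0 a'b0]] := common_nbrA aA a'A (subsetDl B U) hB'.
  rewrite inE => /andP[b0U _].
  by apply: (@connect_via _ b0); apply: (beta_cross clU); rewrite // (negPf b0U) ?aU ?a'U.
move=> C D cov; rewrite leqNgt; apply/negP => lt.
have l1 := cardD_le (A :&: U) C; have l2 := cardD_le (B :\: U) D.
have [E|[a]] := set_0Vmem ((A :&: U) :\: C); first by move: l1; rewrite E cards0; lia.
have [E|[b]] := set_0Vmem ((B :\: U) :\: D); first by move: l2; rewrite E cards0; lia.
rewrite !inE => /and3P[bD bU bB] /andP[aC /andP[aA aU]].
have := @nonadjA a ((B :\: U) :\: D) aA; have := @nonadjB b ((A :&: U) :\: C) bB.
move=> h1 h2.
have {}h1 : 4 * #|(A :&: U) :\: C| < m.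
  apply: h1; first by rewrite (subset_trans (subsetDl _ _)) // subsetIl.
  move=> x; rewrite !inE => /and3P[xC xA xU]; apply/negP => xb.
  by have := cov x b xA bB; rewrite xb xU bU (negPf xC) (negPf bD) => /(_ isT).
have {}h2 : 4 * #|(B :\: U) :\: D| < m.
  apply: h2; first by rewrite (subset_trans (subsetDl _ _)) // subsetDl.
  move=> y; rewrite !inE => /and3P[yD yU yB]; apply/negP => ay.
  by have := cov a y aA yB; rewrite ay aU yU (negPf aC) (negPf yD) => /(_ isT).
lia.
Qed.

(* Every vertex of A outside P reaches B :&: P, and B :&: P is connected through A \ P.    *)
(* A vertex of A outside both P and Q then links everything.                               *)
Lemma connect_groups P Q : color_closed P -> color_closed Q -> [disjoint P & Q] ->
  2 * #|A :&: P| < m -> 2 * #|A :&: Q| < m -> m <= 4 * #|B :&: P| -> m <= 4 * #|B :&: Q| ->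
  {in A &, forall a a', connect beta a a'}.
Proof.
move=> clP clQ dPQ aP aQ bP bQ.
have half S : color_closed S -> 2 * #|A :&: S| < m -> m <= 4 * #|B :&: S| ->
    forall a a', a \in A -> a' \in A -> a \notin S -> a' \notin S -> connect beta a a'.
  move=> clS aS bS a a' aA a'A naS na'S.
  have [b + ab] := nbrA aA (subsetIl B S) bS; rewrite inE => /andP[bB bS1].
  have [b' + ab'] := nbrA a'A (subsetIl B S) bS; rewrite inE => /andP[b'B bS1'].
  have cAS := cardsID S A.
  have [|c [+ cb cb']] := common_nbrB bB b'B (subsetDl A S); first by lia.
  rewrite inE => /andP[cS cA'].
  by apply: (@connect_trans _ _ c); [apply: (@connect_via _ b)|apply: (@connect_via _ b')];
    apply: (beta_cross clS); rewrite // ?(negPf naS) ?(negPf na'S) ?(negPf cS) ?bS1 ?bS1'.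
have [w wA [wP wQ]] : exists2 w, w \in A & w \notin P /\ w \notin Q.
  have [leU _] := leq_card_setU (A :&: P) (A :&: Q).
  have [E|[w]] := set_0Vmem (A :\: (P :|: Q)).
    by have := cardsID (P :|: Q) A; rewrite E cards0 setIUr; lia.
  by rewrite !inE negb_or => /andP[/andP[? ?] ?]; exists w.
have cs := sym_connect_sym beta_sym.
suff toW a : a \in A -> connect beta a w.
  by move=> a a' aA a'A; apply: connect_trans (toW _ aA) _; rewrite cs toW.
move=> aA; have [aPP|] := boolP (a \in P); last by move=> naP; apply: (half P).
by apply: (half Q) => //; rewrite (disjointFr dPQ).
Qed.

(** Edges between different groups are [beta]-edges. After deleting fewer than q <= m / 2 vertices,
    more than half of [A] survives, hence vertices u and u' of different groups. Every survivor in
    [B] lies outside the group of u or that of u' and so is missed by one of them, which leaves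
    fewer than m / 2 survivors in [B], too few. *)
Lemma beta_cover_groups (grp : V -> nat) q (C D : {set V}) : 2 * q <= m ->
  (forall u v, rho u v -> grp u = grp v) ->
  (forall i, 2 * #|[set a in A | grp a == i]| < m) ->
  (forall a b, a \in A -> b \in B -> beta a b -> (a \in C) || (b \in D)) ->
  q <= #|C| + #|D|.
Proof.
move=> q2 cl small cov; rewrite leqNgt; apply/negP => lt.
have lA := cardD_le A C; have lB := cardD_le B D.
have nonadj u : u \in A :\: C -> 4 * #|[set b in B :\: D | grp b != grp u]| < m.
  rewrite inE => /andP[uC uA]; apply: (nonadjA uA).
    by apply/subsetP => b; rewrite !inE => /andP[/andP[]].
  move=> b; rewrite !inE => /andP[/andP[bD bB] ne]; apply/negP => /orP[/cl E|].
    by rewrite E eqxx in ne.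
  by move=> /(cov _ _ uA bB); rewrite (negPf uC) (negPf bD).
have [E|[u uA']] := set_0Vmem (A :\: C); first by move: lA; rewrite E cards0; lia.
have [u' u'A' ne] : exists2 u', u' \in A :\: C & grp u' != grp u.
  apply: contrapT => nex; have := small (grp u).
  suff : #|A :\: C| <= #|[set a in A | grp a == grp u]| by lia.
  apply/subset_leq_card/subsetP => x xA'; rewrite inE.
  have /setDP[-> _] /= := xA'; apply/negP => /negP ne.
  by apply: nex; exists x.
have := nonadj _ uA'; have := nonadj _ u'A'.
set S1 := [set b in _ | _]; set S2 := [set b in _ | _].
suff : #|B :\: D| <= #|S1| + #|S2| by lia.
have [leU _] := leq_card_setU S1 S2; apply: leq_trans leU.
apply/subset_leq_card/subsetP => b; rewrite !inE => /andP[-> ->] /=.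
by have [->|] := eqVneq (grp b) (grp u); rewrite ?orbT // eq_sym ne.
Qed.

(** [U], [D] and the remainder [W] each hold less than half of both sides. Hence at least two of the
    three hold a quarter of [B], and these two make [beta] connected on [A]. *)
Lemma matching_groups U D q : 2 * q <= m ->
  color_closed U -> color_closed D -> [disjoint U & D] ->
  2 * #|A :&: U| < m -> 2 * #|B :&: U| < m -> 2 * #|A :&: D| < m -> 2 * #|B :&: D| < m ->
  m < 2 * #|A :&: (U :|: D)| -> m < 2 * #|B :&: (U :|: D)| ->
  connected_matching beta q.
Proof.
move=> q2 clU clD dUD aU bU aD bD aUD bUD.
pose W := ~: (U :|: D).
have clW : color_closed W by apply: color_closedC; apply: color_closedU.
have dUW : [disjoint U & W] by rewrite disjoints_subset setCK subsetUl.
have dDW : [disjoint D & W] by rewrite disjoints_subset setCK subsetUr.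
have cAW := cardsID (U :|: D) A; have cBW := cardsID (U :|: D) B.
have [leA _] := leq_card_setU (A :&: U) (A :&: D).
have [leB _] := leq_card_setU (B :&: U) (B :&: D).
rewrite -!setIUr in leA leB; rewrite !setDE -/W in cAW cBW.
have conn : {in A &, forall a a', connect beta a a'}.
  have [h1|h1] := leqP m (4 * #|B :&: U|); have [h2|h2] := leqP m (4 * #|B :&: D|).
  - by apply: (connect_groups clU clD).
  - by apply: (connect_groups clU clW); lia.
  - by apply: (connect_groups clD clW); lia.
  - by lia.
apply: (@connected_matching_of_covers _ A B _ beta) => //.
  by move=> a b a' b' aA _ _ a'A _ _; apply: conn.
pose grp x := if x \in U then 0 else if x \in D then 1 else 2.
move=> C E; apply: (@beta_cover_groups grp) => //.
  by move=> u v uv; rewrite /grp (clU _ _ uv) (clD _ _ uv).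
move=> i; have [E0|ne0] := eqVneq i 0.
  apply: leq_ltn_trans aU; rewrite leq_mul2l /=; apply/subset_leq_card/subsetP => x.
  by rewrite !inE E0 /grp => /andP[->]; case: ifP => //; case: ifP.
have [E1|ne1] := eqVneq i 1.
  apply: leq_ltn_trans aD; rewrite leq_mul2l /=; apply/subset_leq_card/subsetP => x.
  by rewrite !inE E1 /grp => /andP[->]; case: ifP => //; case: ifP.
apply: (@leq_ltn_trans (2 * #|A :&: W|)); last by lia.
rewrite leq_mul2l /=; apply/subset_leq_card/subsetP => x.
rewrite !inE /grp => /andP[->]; case: ifP => _ /eqP; first by lia.
by case: ifP => // _; lia.
Qed.

(* (C1, C2) is a cover of the rho-edges inside D, so the edges that avoid it and meet D    *)
(* are all beta-edges.                                                                     *)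
Lemma matching_gamma D (C1 C2 : {set V}) q : color_closed D ->
  2 * #|A :\: D| < m -> 2 * #|B :\: D| < m ->
  (forall a b, a \in A -> b \in B -> rho a b -> a \in D -> (a \in C1) || (b \in C2)) ->
  #|C1| + #|C2| + q < m ->
  (forall a b a' b', a \in A -> b \in B -> a \notin C1 -> b \notin C2 ->
      (a \in D) || (b \in D) -> beta a b ->
      a' \in A -> b' \in B -> a' \notin C1 -> b' \notin C2 ->
      (a' \in D) || (b' \in D) -> beta a' b' -> connect beta a a') ->
  connected_matching beta q.
Proof.
move=> clD sA sB covD ltC conn.
pose ga a b := [&& adj a b, a \notin C1, b \notin C2 & (a \in D) || (b \in D)].
have gab a b : a \in A -> b \in B -> ga a b -> beta a b.
  move=> aA bB /and4P[/orP[rab|//] aC bC ab].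
  have E := clD _ _ rab; rewrite -E orbb in ab.
  by have := covD _ _ aA bB rab ab; rewrite (negPf aC) (negPf bC).
apply: (@connected_matching_of_covers _ A B _ ga) => //.
  move=> a b a' b' aA bB g1 a'A b'B g2.
  have := gab _ _ aA bB g1; have := gab _ _ a'A b'B g2.
  move: g1 g2 => /and4P[_ ? ? ?] /and4P[_ ? ? ?] h1 h2.
  exact: (conn a b a' b').
move=> E F cov; rewrite leqNgt; apply/negP => lt.
pose A' := A :\: (C1 :|: E); pose B' := B :\: (C2 :|: F).
have lA := cardD_le A (C1 :|: E); have lB := cardD_le B (C2 :|: F).
have [lU1 _] := leq_card_setU C1 E; have [lU2 _] := leq_card_setU C2 F.
rewrite -/A' -/B' in lA lB.
have A'A : A' \subset A by apply: subsetDl.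
have B'B : B' \subset B by apply: subsetDl.
have non a b : a \in A' -> b \in B' -> (a \in D) || (b \in D) -> ~~ adj a b.
  move=> /setDP[aA]; rewrite inE => /norP[aC aE].
  move=> /setDP[bB]; rewrite inE => /norP[bC bF] ab.
  apply/negP => adjab; have := cov _ _ aA bB.
  by rewrite /ga adjab aC bC ab (negPf aE) (negPf bF) => /(_ isT).
have lA' := subset_leq_card A'A; have lB' := subset_leq_card B'B.
have cA' := cardsID D A'; have cB' := cardsID D B'.
have lAD : #|A' :\: D| <= #|A :\: D| by apply/subset_leq_card/setSD.
have lBD : #|B' :\: D| <= #|B :\: D| by apply/subset_leq_card/setSD.
have toA a (S : {set V}) : a \in A' -> S \subset B' -> (forall b, b \in S -> (a \in D) || (b \in D)) ->
    4 * #|S| < m.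
  move=> aA' SB H; apply: (@nonadjA a); first exact: (subsetP A'A).
    exact: subset_trans SB B'B.
  by move=> b bS; apply: non => //; [apply: (subsetP SB)|apply: H].
have toB b (S : {set V}) : b \in B' -> S \subset A' -> (forall a, a \in S -> (a \in D) || (b \in D)) ->
    4 * #|S| < m.
  move=> bB' SA H; apply: (@nonadjB b); first exact: (subsetP B'B).
    exact: subset_trans SA A'A.
  by move=> a aS; apply: non => //; [apply: (subsetP SA)|apply: H].
(* More than m vertices survive in [A'] and [B'] together. A survivor in [D] leaves fewer than m / 4
   survivors opposite, any survivor leaves fewer than m / 4 opposite survivors in [D], and fewer
   than m / 2 on each side lie outside [D]; every case contradicts the count. *)
have [E1|[a]] := set_0Vmem (A' :&: D); have [E2|[b]] := set_0Vmem (B' :&: D).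
- by move: cA' cB'; rewrite E1 E2 cards0; lia.
- move=> /setIP[bB' bD].
  have [E3|[a aA']] := set_0Vmem A'; first by move: lA; rewrite E3 cards0; lia.
  have h1 : 4 * #|A'| < m by apply: (toB b) => // x _; rewrite bD orbT.
  have h2 : 4 * #|B' :&: D| < m.
    by apply: (toA a); rewrite ?subsetIl // => y; rewrite inE => /andP[_ ->]; rewrite orbT.
  by lia.
- move=> /setIP[aA' aD].
  have [E3|[b bB']] := set_0Vmem B'; first by move: lB; rewrite E3 cards0; lia.
  have h1 : 4 * #|B'| < m by apply: (toA a) => // x _; rewrite aD.
  have h2 : 4 * #|A' :&: D| < m.
    by apply: (toB b); rewrite ?subsetIl // => y; rewrite inE => /andP[_ ->].
  by lia.
- move=> /setIP[bB' bD] /setIP[aA' aD].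
  have h1 : 4 * #|B'| < m by apply: (toA a) => // x _; rewrite aD.
  have h2 : 4 * #|A'| < m by apply: (toB b) => // x _; rewrite bD orbT.
  by lia.
Qed.

(** König's theorem inside the red component [D] gives the red matching or a cover with fewer than m
    - q vertices. In the latter case it remains to connect the [beta]-edges that avoid a cover and
    meet [D]. If a cover leaves half of [A] or of [B] inside [D], common neighbours there connect
    them ([gamA], [gamB]). *)
Lemma matching_large v q : 2 * q <= m ->
  m < 2 * #|A :&: [set w | connect rho v w]| ->
  m < 2 * #|B :&: [set w | connect rho v w]| ->
  connected_matching rho (m - q) \/ connected_matching beta q.
Proof.
set D := [set w | connect rho v w] => q2 hA hB.
have clD : color_closed D := @color_closed_component v.
have cAD := cardsID D A; have cBD := cardsID D B.
have [covD|] := pselect (forall C1 C2 : {set V},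
  (forall a b, a \in A -> b \in B -> (a \in D) && rho a b -> (a \in C1) || (b \in C2)) ->
  m - q <= #|C1| + #|C2|).
  left; apply: (connected_matching_of_covers dAB _ _ covD).
    by move=> a b _ _ /andP[].
  move=> a b a' b' _ _ /andP[aD _] _ _ /andP[a'D _].
  move: aD a'D; rewrite !inE => va va'; apply: connect_trans va'.
  by rewrite (sym_connect_sym rho_sym).
move=> /existsNP[C1'] /existsNP[C2'] /not_implyP[cov' /negP]; rewrite -ltnNge => lt'.
right; clearbody D.
have gam := @matching_gamma D _ _ q clD.
have adj_beta (C1 C2 : {set V}) a b :
    (forall a b, a \in A -> b \in B -> rho a b -> a \in D -> (a \in C1) || (b \in C2)) ->
    a \in A -> b \in B -> a \notin C1 -> b \notin C2 -> (a \in D) || (b \in D) ->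
    adj a b -> beta a b.
  move=> cov aA bB aC bC ab /orP[rab|//].
  have E := clD _ _ rab; rewrite -E orbb in ab.
  by have := cov _ _ aA bB rab ab; rewrite (negPf aC) (negPf bC).
have gamA (C1 C2 : {set V}) :
    (forall a b, a \in A -> b \in B -> rho a b -> a \in D -> (a \in C1) || (b \in C2)) ->
    #|C1| + #|C2| + q < m -> m <= 2 * #|(A :&: D) :\: C1| -> connected_matching beta q.
  move=> cov lt h; apply: (gam C1 C2) => //; [lia|lia|].
  move=> a b a' b' aA bB aC bC ab bab a'A b'B a'C b'C a'b' ba'b'.
  have [|c [+ cb cb']] := common_nbrB bB b'B _ h.
    by rewrite (subset_trans (subsetDl _ _)) ?subsetIl.
  rewrite !inE => /and3P[cC cA' cD].
  apply: (@connect_trans _ _ c).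
    by apply: (connect_via bab); apply: (adj_beta C1 C2); rewrite ?cD.
  by apply: connect_via ba'b'; apply: (adj_beta C1 C2); rewrite ?cD.
have gamB (C1 C2 : {set V}) :
    (forall a b, a \in A -> b \in B -> rho a b -> a \in D -> (a \in C1) || (b \in C2)) ->
    #|C1| + #|C2| + q < m -> m <= 2 * #|(B :&: D) :\: C2| -> connected_matching beta q.
  move=> cov lt h; apply: (gam C1 C2) => //; [lia|lia|].
  move=> a b a' b' aA bB aC bC ab bab a'A b'B a'C b'C a'b' ba'b'.
  have [|c [+ ac a'c]] := common_nbrA aA a'A _ h.
    by rewrite (subset_trans (subsetDl _ _)) ?subsetIl.
  rewrite !inE => /and3P[cC cB' cD].
  by apply: (@connect_via _ c); apply: (adj_beta C1 C2); rewrite ?cD ?orbT.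
(* If [D] has fewer than m - q vertices on one side, these form a cover by themselves and the part
   of [D] on the other side, more than half, is untouched. *)
have [ltB|geB] := ltnP #|B :&: D| (m - q).
  apply: (gamA set0 (B :&: D)); rewrite ?cards0 ?setD0; try lia.
  by move=> a b _ bB /clD E aD; rewrite !inE bB -E aD.
have [ltA|geA] := ltnP #|A :&: D| (m - q).
  apply: (gamB (A :&: D) set0); rewrite ?cards0 ?setD0; try lia.
  by move=> a b aA _ _ aD; rewrite !inE aA aD.
pose C1 := C1' :&: (A :&: D); pose C2 := C2' :&: (B :&: D).
have l1 : #|C1| <= #|C1'| by apply/subset_leq_card/subsetIl.
have l2 : #|C2| <= #|C2'| by apply/subset_leq_card/subsetIl.
have cov a b : a \in A -> b \in B -> rho a b -> a \in D -> (a \in C1) || (b \in C2).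
  move=> aA bB rab aD; have := cov' _ _ aA bB.
  by rewrite aD rab !inE aA bB aD -(clD _ _ rab) aD !andbT => /(_ isT).
have lt : #|C1| + #|C2| + q < m by lia.
have [|h1] := leqP m (2 * #|(A :&: D) :\: C1|); first exact: gamA cov lt.
have [|h2] := leqP m (2 * #|(B :&: D) :\: C2|); first exact: gamB cov lt.
have e1 := cardsD (A :&: D) C1; have e2 := cardsD (B :&: D) C2.
have e3 := cardsD A C1; have e4 := cardsD B C2.
have s1 : C1 \subset A :&: D := subsetIr _ _.
have s2 : C2 \subset B :&: D := subsetIr _ _.
rewrite (setIidPr s1) in e1; rewrite (setIidPr s2) in e2.
rewrite (setIidPr (subset_trans s1 (subsetIl _ _))) in e3.
rewrite (setIidPr (subset_trans s2 (subsetIl _ _))) in e4.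
have l3 : #|C1| <= #|A :&: D| by apply/subset_leq_card/subsetIr.
have l4 : #|C2| <= #|B :&: D| by apply/subset_leq_card/subsetIr.
pose A1 := (A :&: D) :\: C1; pose B1 := (B :&: D) :\: C2.
rewrite -/A1 in h1 e1; rewrite -/B1 in h2 e2.
have A1P a : a \in A1 -> [/\ a \in A, a \in D & a \notin C1].
  by rewrite inE => /andP[-> /setIP[-> ->]].
have B1P b : b \in B1 -> [/\ b \in B, b \in D & b \notin C2].
  by rewrite inE => /andP[-> /setIP[-> ->]].
have cs := sym_connect_sym beta_sym.
(* Since [A :&: D] has at least m - q vertices and fewer than m / 2 of them avoid [C1], the bound on
   the cover gives |C2| <= m / 2. So [B :\: C2] is large enough for common neighbours; [connB] is
   symmetric. *)
have connA : {in A1 &, forall a a', connect beta a a'}.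
  move=> a a' /A1P[aA aD aC] /A1P[a'A a'D a'C].
  have [|c [+ ac a'c]] := common_nbrA aA a'A (subsetDl B C2); first by lia.
  rewrite inE => /andP[cC cB'].
  by apply: (@connect_via _ c); apply: (adj_beta C1 C2); rewrite ?aD ?a'D.
have connB : {in B1 &, forall b b', connect beta b b'}.
  move=> b b' /B1P[bB bD bC] /B1P[b'B b'D b'C].
  have [|c [+ cb cb']] := common_nbrB bB b'B (subsetDl A C1); first by lia.
  rewrite inE => /andP[cC cA'].
  by apply: (@connect_via _ c); rewrite beta_sym; apply: (adj_beta C1 C2);
    rewrite ?bD ?b'D ?orbT.
(* |A1| + |B1| > m - q >= m / 2 with both terms below m / 2: both sets are nonempty and one has at
   least m / 4 vertices. The edge found links the class of [A1] to that of [B1]. *)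
have [a0 [b0 [a0A1 b0B1 ab0]]] : exists a0 b0, [/\ a0 \in A1, b0 \in B1 & adj a0 b0].
  have sA1 : A1 \subset A by apply/subsetP => x /A1P[].
  have sB1 : B1 \subset B by apply/subsetP => x /B1P[].
  have [h|h] := leqP m (4 * #|A1|).
    have [E|[b bB1]] := set_0Vmem B1; first by move: e2; rewrite E cards0; lia.
    have [bB _ _] := B1P _ bB1; have [a aA1 ab] := nbrB bB sA1 h.
    by exists a, b.
  have [E|[a aA1]] := set_0Vmem A1; first by move: e1; rewrite E cards0; lia.
  have [aA _ _] := A1P _ aA1; have [|b bB1 ab] := nbrA aA sB1; first by lia.
  by exists a, b.
have bab0 : beta a0 b0.
  have [? ? ?] := A1P _ a0A1; have [? ? ?] := B1P _ b0B1.
  by apply: (adj_beta C1 C2) => //; apply/orP; left.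
have toa0 a b : a \in A -> b \in B -> a \notin C1 -> b \notin C2 ->
    (a \in D) || (b \in D) -> beta a b -> connect beta a a0.
  move=> aA bB aC bC /orP[aD|bD] bab.
    by apply: connA => //; apply/setDP; split; rewrite // inE aA.
  apply: (@connect_trans _ _ b); first exact: connect1.
  apply: (@connect_trans _ _ b0); last by rewrite cs; apply: connect1.
  by apply: connB => //; apply/setDP; split; rewrite // inE bB.
apply: (gam C1 C2) => //; [lia|lia|].
move=> a b a' b' *; apply: (@connect_trans _ _ a0); first exact: (toa0 a b).
by rewrite cs; apply: (toa0 a' b').
Qed.

Lemma connected_matching_two_colors q : 2 * q <= m ->
  connected_matching rho (m - q) \/ connected_matching beta q.
Proof.
move=> q2.
have [m0|m_gt0] := posnP m.
  by right; exists [::]; split => //=; lia.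
have [bad|nobad] := pselect (connected_matching beta q); first by right.
(* [matching_mixed], applied to [U] and to its complement, excludes every closed set that is at
   least half on one side and at most half on the other. *)
have dich U : color_closed U -> (2 * #|A :&: U| < m /\ 2 * #|B :&: U| < m) \/
    (m < 2 * #|A :&: U| /\ m < 2 * #|B :&: U|).
  move=> clU; have := matching_mixed q2 clU; have := matching_mixed q2 (color_closedC clU).
  rewrite -!setDE => h1 h2.
  have cAU := cardsID U A; have cBU := cardsID U B.
  have [a1|a1] := leqP m (2 * #|A :&: U|).
    have [b1|b1] := leqP (2 * #|B :&: U|) m; first by case: nobad; apply: h2.
    right; split => //; rewrite ltnNge; apply/negP => a2.
    by apply: nobad; apply: h1; lia.
  left; split => //; rewrite ltnNge; apply/negP => b1.
  by apply: nobad; apply: h1; lia.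
have [[v [hA hB]]|nolarge] := pselect (exists v,
    m < 2 * #|A :&: [set w | connect rho v w]| /\ m < 2 * #|B :&: [set w | connect rho v w]|).
  exact: (@matching_large v).
pose small (U : {set V}) := `[< [/\ color_closed U, 2 * #|A :&: U| < m & 2 * #|B :&: U| < m] >].
have small0 : small set0.
  by apply/asboolP; split; [move=> u v _; rewrite !inE|rewrite setI0 cards0|rewrite setI0 cards0].
(* [U] is a largest closed set below half on both sides. Adding the component [D] of a vertex
   outside breaks this, so by [dich] the union exceeds half on both sides, and [U], [D] and the rest
   are three small groups. *)
have [U /asboolP[clU aU bU] maxU] := arg_maxnP (fun U : {set V} => #|U|) small0.
have [E|[v]] := set_0Vmem (A :\: U).
  by have := cardsID U A; rewrite E cards0; lia.
rewrite inE => /andP[vU vA].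
pose D := [set w | connect rho v w].
have clD : color_closed D := @color_closed_component v.
have dUD : [disjoint U & D].
  rewrite -setI_eq0; apply/eqP/setP => w; rewrite !inE; apply/negP => /andP[wU vw].
  have clU' : closed rho (mem U) by move=> x y /clU.
  by have := closed_connect clU' vw; rewrite wU (negPf vU).
have vD : v \in D by rewrite inE.
right; case: (dich D clD) => [[aD bD]|large]; last by case: nolarge; exists v.
case: (dich (U :|: D) (color_closedU clU clD)) => [[aUD bUD]|[aUD bUD]].
  have /maxU /= : small (U :|: D) by apply/asboolP; split => //; apply: color_closedU.
  rewrite leqNgt => /negP[]; apply: proper_card; apply/properP; split; first exact: subsetUl.
  by exists v; rewrite // inE vD orbT.
exact: (matching_groups q2 clU clD).
Qed.
End Core.

(** * Closed walks and their embedding *)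

(** As in [path], the starting vertex [u] is not listed. *)
Definition back_and_forth (V : Type) (t : nat) (u v : V) : seq V := flatten (nseq t [:: v; u]).

Lemma back_and_forthP (V : eqType) (rho : rel V) t u v : rho u v -> rho v u ->
  [/\ path rho u (back_and_forth t u v), last u (back_and_forth t u v) = u &
      size (back_and_forth t u v) = 2 * t].
Proof.
move=> uv vu; elim: t => [//|t [IH1 IH2 IH3]].
by rewrite /back_and_forth /= uv vu -/(back_and_forth t u v); split => //; rewrite IH3; lia.
Qed.

Lemma count_back_and_forth (V : eqType) t (u v z : V) : u != v ->
  count_mem z (back_and_forth t u v) = if z \in [:: u; v] then t else 0.
Proof.
move=> uv; elim: t => [|t IH]; first by case: ifP.
rewrite /back_and_forth /= -/(back_and_forth t u v) IH !inE ![_ == z]eq_sym.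
by have [->|_] := eqVneq z u; [rewrite (negPf uv)|case: (z == v)].
Qed.

(** The bound uses a set [Rl] containing all heads of edges instead of the whole type: later it is
    the set of clusters, whose number stays bounded. *)
Lemma short_path (V : finType) (rho : rel V) (Rl : {set V}) (x y : V) :
  (forall u v, rho u v -> v \in Rl) -> connect rho x y ->
  exists p, [/\ path rho x p, last x p = y & size p <= #|Rl|].
Proof.
move=> sub /connectP[p0 p0P ->]; case/shortenP: p0P => p pP /= /andP[_ up] _.
exists p; split => //; rewrite cardE; apply: uniq_leq_size => // z.
rewrite mem_enum; elim: p x pP {up} => //= a p IH x /andP[xa pP].
by rewrite inE => /predU1P[->|/(IH _ pP)//]; apply: sub xa.
Qed.

Lemma last_rev_belast (V : Type) (x : V) (p : seq V) : last (last x p) (rev (belast x p)) = x.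
Proof. by case: p => //= y p; rewrite rev_cons last_rcons. Qed.

(** From [z0] the walk goes to each matching edge in turn, oscillates there at most c times and
    returns the same way. [base], half the length of these detours, does not depend on t. Matching
    edges are disjoint, so oscillations visit a vertex at most c times and detours add at most
    [2 * base]. *)
Lemma closed_walk_through (V : finType) (rho : rel V) (Rl : {set V}) (c : nat) :
  symmetric rho -> (forall u v, rho u v -> v \in Rl) ->
  forall (M : seq (V * V)) (z0 : V), uniq (unzip1 M ++ unzip2 M) ->
  {in M, forall uv, rho uv.1 uv.2} -> {in M, forall uv, connect rho z0 uv.1} ->
  exists base, base <= size M * #|Rl| /\ forall t, t <= size M * c ->
  exists w, [/\ path rho z0 w, last z0 w = z0, size w = 2 * (base + t) &
    forall z, count_mem z w <= (if z \in unzip1 M ++ unzip2 M then c else 0) + 2 * base].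
Proof.
move=> sym sub; elim=> [|[u v] M IH] z0.
  move=> _ _ _; exists 0; split => // t; rewrite mul0n leqn0 => /eqP->.
  by exists [::].
move=> uM HM cM; have uv : rho u v by apply: (HM (u, v)); rewrite mem_head.
have vu : rho v u by rewrite sym.
have [p [pP lp sp]] := short_path sub (cM _ (mem_head _ _)).
rewrite /= in lp.
move: uM; rewrite /= mem_cat inE cat_uniq /= negb_or => /and5P[].
rewrite !negb_or => /and3P[u1 uvne u2] M1 /andP[v1 M12] v2 M2.
have [|||base [lb wb]] := IH z0.
- by rewrite cat_uniq M1 M2 M12.
- by move=> x xM; apply: HM; rewrite inE xM orbT.
- by move=> x xM; apply: cM; rewrite inE xM orbT.
exists (size p + base); split; first by rewrite mulSn leq_add.
move=> t; rewrite mulSn => ht.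
(* The first edge takes [minn t c] oscillations and the other edges share the rest. *)
have [|w [w1 w2 w3 w4]] := wb (t - minn t c); first by clear -ht; lia.
have [l1 l2 l3] := back_and_forthP (minn t c) uv vu.
exists (p ++ back_and_forth (minn t c) u v ++ rev (belast z0 p) ++ w); split.
- rewrite !cat_path pP lp l1 l2 /= -{1}lp rev_path -lp last_rev_belast w1 andbT.
  by rewrite (eq_path (e' := rho)) // => x y; rewrite sym.
- by rewrite !last_cat lp l2 -lp last_rev_belast.
- by rewrite !size_cat l3 size_rev size_belast w3; clear; lia.
move=> z; rewrite !count_cat count_back_and_forth //.
have c1 := count_size (pred1 z) p; have c2 := count_size (pred1 z) (rev (belast z0 p)).
rewrite size_rev size_belast in c2.
move: c1 c2 (w4 z); rewrite !inE !mem_cat !inE.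
have [->|zu] := eqVneq z u; first by rewrite (negPf u1) (negPf u2) /=; clear; lia.
have [->|zv] := eqVneq z v; first by rewrite (negPf v1) (negPf v2) /= ?orbT; clear; lia.
by rewrite /=; case: ifP => _; clear; lia.
Qed.

(** Lengths up to [2 * S] come from oscillating on one edge. For longer ones l / 2 exceeds [base],
    and the walk through the whole matching can be tuned to length l. *)
Lemma closed_walk_even (V : finType) (rho : rel V) (Rl : {set V}) (p c S l : nat) :
  symmetric rho -> (forall u v, rho u v -> v \in Rl) ->
  connected_matching rho p -> 0 < p -> c + 2 * (p * #|Rl|) <= S ->
  ~~ odd l -> l <= 2 * (p * c) ->
  exists z w, [/\ path rho z w, last z w = z, size w = l & forall x, count_mem x w <= S].
Proof.
move=> sym sub [M [sM uM HM cM]] p0 cS ol ll.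
have El : l = 2 * l./2 by lia.
case: M sM uM HM cM => [|[u v] M] sM uM HM cM; first by move: sM => /=; lia.
have uv : rho u v by apply: (HM (u, v)); rewrite mem_head.
have vu : rho v u by rewrite sym.
have uvne : u != v.
  by move: uM; rewrite /= mem_cat inE !negb_or => /andP[/and3P[]].
have [lS|Sl] := leqP l (2 * S).
  have [w1 w2 w3] := back_and_forthP l./2 uv vu.
  exists u, (back_and_forth l./2 u v); split => //; first by rewrite w3 -El.
  by move=> x; rewrite count_back_and_forth //; case: ifP => _; clear -lS; lia.
have [|base [lb wb]] := closed_walk_through c sym sub uM HM (z0 := u).
  by move=> xy xyM; apply: (cM (u, v)); rewrite ?mem_head.
rewrite sM in lb wb.
have [|w [w1 w2 w3 w4]] := wb (l./2 - base); first by clear -ll; lia.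
exists u, w; split => //; first by rewrite w3; clear -lb Sl El cS; lia.
by move=> x; apply: leq_trans (w4 x) _; case: ifP => _; clear -lb cS; lia.
Qed.

Lemma exists_subset_card (T : finType) (A : {set T}) n : n <= #|A| ->
  exists2 Q : {set T}, Q \subset A & #|Q| = n.
Proof.
case/card_geqP => s [us <- sA]; exists [set x in s].
  by apply/subsetP => x; rewrite inE => /sA.
by rewrite cardsE; apply/card_uniqP.
Qed.

Definition nbrs (T : finType) (g : rel T) (x : T) (B : {set T}) : {set T} :=
  [set y in B | g x y].

(** The two consequences of regularity that the embedding uses. With more than [3 * ka] neighbours,
    at least [ka] remain after the loss of up to [ka + 1] reserved vertices. *)
Definition joined_pair (T : finType) (g : rel T) (ka M0 : nat) (Z W : {set T}) :=
  (forall A B : {set T}, A \subset Z -> B \subset W -> ka <= #|A| -> ka <= #|B| ->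
     exists x y, [/\ x \in A, y \in B & g x y]) /\
  (forall B : {set T}, B \subset W -> M0 <= #|B| ->
     #|[set x in Z | #|nbrs g x B| <= 3 * ka]| < ka).

(* U collects the vertices already used; the invariant is that the current end vertex has  *)
(* at least ka unused neighbours in the next cluster.                                      *)
Lemma greedy_path (T : finType) (g : rel T) (Rl : {set {set T}}) (rho : rel {set T})
    (ka M0 : nat) :
  0 < ka ->
  (forall Z W x, Z \in Rl -> W \in Rl -> x \in Z -> x \in W -> Z = W) ->
  (forall Z W, rho Z W -> [/\ Z \in Rl, W \in Rl & joined_pair g ka M0 Z W]) ->
  forall (w : seq {set T}) (Z1 : {set T}) (v : T) (U : {set T}),
  Z1 \in Rl -> path rho Z1 w -> ka <= #|nbrs g v (Z1 :\: U)| ->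
  (forall Z, Z \in w -> M0 + count_mem Z (Z1 :: w) <= #|Z :\: U|) ->
  exists vs : seq T,
    [/\ size vs = size w, uniq vs, path g v vs, {in vs, forall x, x \notin U} &
        ka <= #|nbrs g (last v vs) (last Z1 w :\: (U :|: [set x in vs]))|].
Proof.
move=> ka0 disj rhoP; elim=> [|Z2 w IH] Z1 v U Z1R.
  move=> _ hv _; exists [::]; split => //=.
  by rewrite (_ : [set x in [::]] = set0) ?setU0 //; apply/setP => x; rewrite !inE.
move=> /= /andP[Z12 wP] hv hw.
have [_ Z2R [_ deg2]] := rhoP _ _ Z12.
have h2 : M0 < #|Z2 :\: U|.
  by have := hw Z2 (mem_head _ _); rewrite /= eqxx; clear; lia.
have := deg2 (Z2 :\: U) (subsetDl _ _) (ltnW h2).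
set bad := [set x in Z1 | _] => badlt.
have [x] : exists x, x \in nbrs g v (Z1 :\: U) :\: bad.
  apply/set0Pn; rewrite -subset0; apply/negP; rewrite subset0 setD_eq0 => /subset_leq_card.
  by clear -badlt hv; lia.
rewrite !inE => /andP[+ /andP[/andP[xU xZ1] vx]]; rewrite xZ1 /= -ltnNge => xdeg.
pose U' := x |: U.
have [||vs [s1 s2 s3 s4 s5]] := IH Z2 x U' Z2R wP.
- have : nbrs g x (Z2 :\: U) \subset x |: nbrs g x (Z2 :\: U').
    apply/subsetP => y; rewrite !inE negb_or => /andP[/andP[-> ->] ->].
    by case: (y == x).
  move=> /subset_leq_card; rewrite cardsU1; clear -xdeg ka0.
  by case: (_ \notin _) => /=; lia.
- move=> Z Zw; have := hw Z; rewrite inE Zw orbT => /(_ isT) /=.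
  have ZR : Z \in Rl.
    elim: (w) (Z2) wP Zw => //= Y y IHy X /andP[XY yP]; rewrite inE.
    by move=> /predU1P[->|/(IHy _ yP)//]; have [] := rhoP _ _ XY.
  have [<-|ne] := eqVneq Z1 Z.
    have := cardsD1 x (Z1 :\: U); rewrite !inE xU xZ1 /= => E.
    rewrite (_ : Z1 :\: U' = (Z1 :\: U) :\ x); first by rewrite E; clear; lia.
    by apply/setP => y; rewrite !inE negb_or -andbA.
  rewrite (_ : Z :\: U' = Z :\: U); first by clear; lia.
  apply/setP => y; rewrite !inE negb_or; have [->|//] := eqVneq y x.
  rewrite /=; apply/esym/negP => /andP[_ xZ].
  by rewrite (disj Z1 Z x) ?eqxx in ne.
exists (x :: vs); split => //=.
- by rewrite s1.
- by rewrite s2 andbT; apply/negP => /s4; rewrite !inE eqxx.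
- by rewrite vx s3.
- move=> y; rewrite inE => /predU1P[->//|/s4]; rewrite inE negb_or => /andP[_ ->].
  by [].
- apply: leq_trans s5 _; apply/subset_leq_card/subsetP => y; rewrite !inE !negb_or.
  by move=> /andP[/andP[/andP[/andP[-> ->] ->] ->] ->].
Qed.

Lemma embed_closed_walk (T : finType) (g : rel T) (Rl : {set {set T}}) (rho : rel {set T})
    (ka M0 s S : nat) (z : {set T}) (w : seq {set T}) :
  0 < ka -> symmetric g -> irreflexive g -> symmetric rho ->
  (forall Z W x, Z \in Rl -> W \in Rl -> x \in Z -> x \in W -> Z = W) ->
  (forall Z, Z \in Rl -> #|Z| = s) ->
  (forall Z W, rho Z W -> [/\ Z \in Rl, W \in Rl & joined_pair g ka M0 Z W]) ->
  S + M0 + 2 * ka < s ->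
  path rho z w -> last z w = z -> 2 < size w -> (forall x, count_mem x w <= S) ->
  exists c : seq T, [/\ size c = size w, uniq c & cycle g c].
Proof.
move=> ka0 gsym girr rsym disj cardR rhoP hs.
case: w => [//|Z1 w]; case/lastP: w => [//|w zl].
case/lastP: w => [//|w Zl]; rewrite /= !rcons_path !last_rcons => /andP[zZ1 /andP[/andP[wP wZl] Zlz]] Ez.
rewrite !size_rcons Ez in Zlz * => _ cnt.
have [zR Z1R [_ degz1]] := rhoP _ _ zZ1.
have zZl : rho z Zl by rewrite rsym.
have [_ ZlR [_ degzl]] := rhoP _ _ zZl.
have c1 := cardR _ Z1R; have cl := cardR _ ZlR; have cz := cardR _ zR.
have b1 := degz1 Z1 (subxx _); have bl := degzl Zl (subxx _).
rewrite c1 in b1; rewrite cl in bl.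
have {}b1 := b1 ltac:(clear -hs; lia); have {}bl := bl ltac:(clear -hs; lia).
move: b1 bl; set bad1 := [set x in _ | _]; set badl := [set x in _ | _] => b1 bl.
(* [v0] has many neighbours both in the second cluster [Z1] of the closed walk and in the last one
   [Zl]; fewer than [2 * ka] vertices of [z] fail this. *)
have [v0] : exists x, x \in z :\: (bad1 :|: badl).
  apply/set0Pn; rewrite -subset0; apply/negP; rewrite subset0 setD_eq0 => /subset_leq_card.
  by have [lU _] := leq_card_setU bad1 badl; clear -lU b1 bl cz hs; lia.
rewrite !inE negb_or => /andP[/andP[+ +] v0z]; rewrite v0z /= -!ltnNge => d1 dl.
(* Q is reserved so that the path can be closed up at the end. *)
have [|Q QP cQ] := @exists_subset_card _ (nbrs g v0 Zl) ka; first by clear -dl; lia.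
pose U := v0 |: Q.
have cU : #|U| <= ka.+1 by rewrite cardsU1 cQ; clear; case: (_ \notin _); lia.
have leD (B : {set T}) : #|B| <= #|B :\: U| + ka.+1.
  have := cardsID U B; have := subset_leq_card (subsetIr B U); clear -cU; lia.
have wR Z : Z \in w -> Z \in Rl.
  elim: (w) (Z1) wP => //= Y y IHy X /andP[XY yP]; rewrite inE.
  by move=> /predU1P[->|/(IHy _ yP)//]; have [] := rhoP _ _ XY.
have [||vs [s1 s2 s3 s4 s5]] := greedy_path ka0 disj rhoP Z1R wP (v := v0) (U := U).
- apply: leq_trans (_ : #|nbrs g v0 Z1 :\: U| <= _).
    by have := leD (nbrs g v0 Z1); clear -d1 ka0; lia.
  by apply/subset_leq_card/subsetP => y; rewrite !inE => /andP[-> /andP[-> ->]].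
- move=> Z Zw; have := leD Z; rewrite (cardR _ (wR _ Zw)).
  by have := cnt Z; rewrite -!cats1 !count_cat /=; clear -hs; lia.
(* The end of the path has [ka] free neighbours in the last cluster of the walk before [Zl], and [Q]
   has [ka] vertices, so an edge yx joins them; x is adjacent to [v0], which closes the cycle. *)
have [_ _ [joinl _]] := rhoP _ _ wZl.
have [|||y [x [yP xQ yx]]] := joinl _ Q _ _ s5.
- by apply/subsetP => y; rewrite !inE => /andP[/andP[_ ->]].
- by apply: subset_trans QP _; apply/subsetP => y; rewrite inE => /andP[].
- by rewrite cQ.
move: yP; rewrite !inE !negb_or => /andP[/andP[/andP[/andP[yv0 yQ] yvs] yZ] vy].
have v0x : g v0 x by move: (subsetP QP _ xQ); rewrite inE => /andP[].
have xU : x \in U by rewrite !inE xQ orbT.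
have xvs : x \notin vs by apply/negP => /s4; rewrite xU.
have v0vs : v0 \notin vs by apply/negP => /s4; rewrite !inE eqxx.
exists (v0 :: vs ++ [:: y; x]); split.
- by rewrite /= size_cat s1 /=; clear; lia.
- rewrite /= mem_cat !inE cat_uniq s2 /= !inE !negb_or v0vs yvs xvs /= [v0 == y]eq_sym yv0 /=.
  have v0nx : v0 != x by apply/eqP => E; rewrite E girr in v0x.
  by rewrite v0nx andbT; apply/eqP => E; rewrite E girr in yx.
- by rewrite /= rcons_cat cat_path s3 /= vy yx gsym v0x.
Qed.

Lemma colored_cycle_of_cycle (T : finType) (e : rel T) (col : T -> T -> bool) (b : bool)
    (c : seq T) : uniq c -> cycle (fun x y => e x y && (col x y == b)) c ->
  colored_cycle e col b (size c).
Proof.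
case: c => [|x0 c] uc cyc; first by exists (fun i : 'I_0 => False_rect T (notF (ltn_ord i))); split => -[].
set g := fun x y : T => _ in cyc.
exists (fun i => nth x0 (x0 :: c) i); split.
  by move=> i j /eqP; rewrite nth_uniq // => /eqP/val_inj.
move=> i j ->; suff : g (nth x0 (x0 :: c) i) (nth x0 (x0 :: c) (i.+1 %% size (x0 :: c))).
  by move=> /andP[-> /eqP->].
move: cyc => /(pathP x0) /(_ i); rewrite size_rcons => /(_ (ltn_ord i)).
rewrite -rcons_cons !nth_rcons ltn_ord.
have := ltn_ord i; rewrite ltnS leq_eqVlt => /orP[/eqP Ei|lti].
  by rewrite /= Ei modnn ltnn eqxx.
by rewrite modn_small // lti.
Qed.

Import Order.TTheory GRing.Theory Num.Theory.
Local Open Scope ring_scope.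

(** * The regularity lemma *)

(** Partitions are encoded as labellings whose blocks are the fibres; [f'] is the finer one. *)
Definition refines (T : Type) (L L' : Type) (f' : T -> L') (f : T -> L) :=
  forall x y, f' x = f' y -> f x = f y.

Section ConditionalExpectation.
Variables (R : realFieldType) (V : finType).

Definition block (L : eqType) (F : V -> L) (v : V) : {set V} := [set w | F w == F v].

(** Conditional expectation for the uniform measure on [V], given the partition [F]. *)
Definition cexp (L : eqType) (F : V -> L) (phi : V -> R) (v : V) : R :=
  (\sum_(w in block F v) phi w) / #|block F v|%:R.

Variables (L : eqType) (F : V -> L).
Implicit Types (phi psi : V -> R).

Lemma block_gt0 v : 0 < #|block F v|%:R :> R.
Proof. by rewrite ltr0n; apply/card_gt0P; exists v; rewrite inE. Qed.

Lemma block_eq v w : F v = F w -> block F v = block F w.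
Proof. by move=> E; apply/setP => x; rewrite !inE E. Qed.

Lemma cexp_eq phi v w : F v = F w -> cexp F phi v = cexp F phi w.
Proof. by move=> /block_eq E; rewrite /cexp E. Qed.

(** Conditional expectation is the orthogonal projection onto the functions constant on blocks. *)
Lemma sum_cexp_mul phi psi : (forall v w, F v = F w -> psi v = psi w) ->
  \sum_v cexp F phi v * psi v = \sum_v phi v * psi v.
Proof.
move=> inv.
under eq_bigr do rewrite /cexp mulrAC -mulrA big_distrl /=.
rewrite (exchange_big_dep predT) //=; apply: eq_bigr => w _.
rewrite (eq_bigr (fun=> phi w * psi w / #|block F w|%:R)).
  rewrite (eq_bigl (mem (block F w))); last by move=> v; rewrite !inE eq_sym.
  by rewrite sumr_const -(mulr_natr (_ / _)) mulfVK // lt0r_neq0 // block_gt0.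
move=> v; rewrite inE => /eqP E.
by rewrite (block_eq E) (inv _ _ E) mulrA.
Qed.

Lemma sum_cexp phi : \sum_v cexp F phi v = \sum_v phi v.
Proof.
rewrite (eq_bigr (fun v => cexp F phi v * 1)); last by move=> v _; rewrite mulr1.
by rewrite sum_cexp_mul //; apply: eq_bigr => v _; rewrite mulr1.
Qed.

End ConditionalExpectation.

Section Energy.
Variables (R : realFieldType) (V : finType) (L L' : eqType) (F : V -> L) (F' : V -> L').
Hypothesis ref : refines F' F.
Variable phi : V -> R.

Let delta v := cexp F' phi v - cexp F phi v.

(** Pythagoras: the projection onto the coarser space is orthogonal to the difference of the two
    projections. *)
Lemma sum_cexp_sqr :
  \sum_v cexp F' phi v ^+ 2 = \sum_v cexp F phi v ^+ 2 + \sum_v delta v ^+ 2.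
Proof.
have h1 : \sum_v cexp F' phi v * cexp F phi v = \sum_v phi v * cexp F phi v.
  by apply: sum_cexp_mul => v w /ref; apply: cexp_eq.
have h2 : \sum_v cexp F phi v * cexp F phi v = \sum_v phi v * cexp F phi v.
  by apply: sum_cexp_mul => v w; apply: cexp_eq.
rewrite -big_split /=.
rewrite [RHS](eq_bigr (fun v => cexp F' phi v ^+ 2 +
   2 * (cexp F phi v * cexp F phi v - cexp F' phi v * cexp F phi v))).
  by rewrite big_split /= -mulr_sumr sumrB h1 h2 subrr mulr0 addr0.
by move=> v _; rewrite /delta; ring.
Qed.

Lemma sum_delta (S : {set V}) v : S \subset block F v ->
  (forall w w', F' w = F' w' -> (w \in S) = (w' \in S)) ->
  \sum_(w in S) delta w = \sum_(w in S) phi w - cexp F phi v * #|S|%:R.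
Proof.
move=> SB mS.
have h (psi : V -> R) : \sum_(w in S) psi w = \sum_w psi w * (w \in S)%:R.
  by rewrite big_mkcond; apply: eq_bigr => w _; case: (w \in S); rewrite ?mulr1 ?mulr0.
rewrite sumrB (h (cexp F' phi)) sum_cexp_mul -?h; last by move=> x y /mS->.
congr (_ - _); rewrite (eq_bigr (fun=> cexp F phi v)).
  by rewrite sumr_const mulr_natr.
by move=> w /(subsetP SB); rewrite inE => /eqP; apply: cexp_eq.
Qed.

(** Cauchy-Schwarz, obtained from the nonnegative sum of the squares (n psi - s)^2. *)
Lemma sqr_sum_le (S : {set V}) (psi : V -> R) :
  (\sum_(w in S) psi w) ^+ 2 <= #|S|%:R * \sum_(w in S) psi w ^+ 2.
Proof.
have [->|[x xS]] := set_0Vmem S; first by rewrite cards0 !big_set0 expr2 !mul0r.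
have n0 : 0 < #|S|%:R :> R by rewrite ltr0n; apply/card_gt0P; exists x.
set s := \sum_(w in S) psi w; set n := #|S|%:R in n0 *.
have : 0 <= \sum_(w in S) (n * psi w - s) ^+ 2 by apply: sumr_ge0 => w _; apply: sqr_ge0.
rewrite (eq_bigr (fun w => n ^+ 2 * psi w ^+ 2 + ((- 2 * n * s) * psi w + s ^+ 2))); last first.
  by move=> w _; ring.
rewrite big_split /= big_split /= sumr_const -(mulr_natr (s ^+ 2)) -/n -!mulr_sumr -/s.
set q := \sum_(w in S) _ => h.
have : 0 <= n * (n * q - s ^+ 2).
  by apply: le_trans h _; rewrite le_eqVlt; apply/orP; left; apply/eqP; ring.
by rewrite pmulr_rge0 // subr_ge0.
Qed.

(** By Cauchy-Schwarz the sum of delta^2 over [S] is at least e^2 |S|, and |S| is at least e^2 times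
    the block. *)
Lemma cexp_delta_ge (S : {set V}) v (e : R) : 0 < e -> S \subset block F v ->
  (forall w w', F' w = F' w' -> (w \in S) = (w' \in S)) ->
  e ^+ 2 * #|block F v|%:R <= #|S|%:R ->
  e * #|S|%:R < `|\sum_(w in S) phi w - cexp F phi v * #|S|%:R| ->
  e ^+ 4 <= cexp F (fun w => delta w ^+ 2) v.
Proof.
move=> e0 SB mS sS; rewrite -(sum_delta SB mS) => big.
have b0 : 0 < #|block F v|%:R :> R := block_gt0 R F v.
have s0 : 0 < #|S|%:R :> R.
  by apply: lt_le_trans sS; rewrite mulr_gt0 // exprn_gt0.
rewrite /cexp ler_pdivlMr //.
have h1 : \sum_(w in S) delta w ^+ 2 <= \sum_(w in block F v) delta w ^+ 2.
  rewrite [X in _ <= X](big_setID S) /= (setIidPr SB) lerDl.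
  by apply: sumr_ge0 => w _; apply: sqr_ge0.
apply: le_trans h1; have := sqr_sum_le S delta.
have h2 : (e * #|S|%:R) ^+ 2 <= (\sum_(w in S) delta w) ^+ 2.
  rewrite -[X in _ <= X]real_normK ?num_real // lerXn2r ?nnegrE ?normr_ge0 ?(ltW big) //.
  by rewrite mulr_ge0 // ltW.
move=> /(le_trans h2); rewrite exprMn [_ ^+ 2 * _ ^+ 2]mulrC expr2 -mulrA ler_pM2l //.
apply: le_trans; rewrite (_ : e ^+ 4 * _ = e ^+ 2 * #|block F v|%:R * e ^+ 2); last by ring.
by rewrite ler_pM2r // exprn_gt0.
Qed.
End Energy.

Lemma card_index_range (T : finType) (e : seq T) a b : uniq e -> (b <= size e)%N ->
  #|[set z in e | (a <= index z e < b)%N]| = (b - a)%N.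
Proof.
move=> ue lb; have [ltab|leba] := ltnP a b; last first.
  rewrite (_ : [set z in e | _] = set0) ?cards0; first by clear -leba; lia.
  by apply/setP => z; rewrite !inE; apply/negP; clear -leba; lia.
case: e ue lb => [|x0 e] ue lb; first by move: lb ltab => /=; lia.
set E := x0 :: e in ue lb *; clearbody E.
have us : uniq [seq nth x0 E i | i <- iota a (b - a)].
  rewrite map_inj_in_uniq ?iota_uniq // => i j; rewrite !mem_iota => hi hj /eqP.
  have hi' : (i < size E)%N by clear -hi lb ltab; lia.
  have hj' : (j < size E)%N by clear -hj lb ltab; lia.
  by rewrite nth_uniq // => /eqP.
rewrite -[RHS](size_iota a) -(size_map (nth x0 E)) -(card_uniqP us).
apply: eq_card => z; rewrite !inE; apply/andP/mapP => [[zE hz]|[i]].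
  exists (index z E); last by rewrite nth_index.
  by rewrite mem_iota; clear -hz; lia.
rewrite mem_iota => hi ->; have hi' : (i < size E)%N by clear -hi lb ltab; lia.
by rewrite mem_nth // index_uniq //; split => //; clear -hi ltab; lia.
Qed.

(** Each class of [h] is enumerated and cut into chunks of [s = n %/ c] elements. Only the last
    chunk of a class can be incomplete, so fewer than s vertices per class are lost, at most
    [K * s <= eps * n] in all. *)
Lemma equitable_refinement (R : realType) (eps : R) (K : nat) : 0 < eps ->
  exists K' n0 : nat, forall (T : finType) (h : T -> nat),
  (n0 <= #|T|)%N -> (forall x, h x < K)%N ->
  exists (f : T -> nat) (s : nat),
  [/\ (forall x, f x < K')%N, refines f h,
      #|[set x | #|block f x| != s]|%:R <= eps * #|T|%:R,
      (0 < s)%N /\ (#|T| <= s * K')%N & s%:R <= eps * #|T|%:R].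
Proof.
move=> e0.
(* [K.+1] instead of [K] also yields [1 <= eps * c], needed for the bound on s. *)
pose c := Num.bound (K.+1%:R / eps).
have c1 : K.+1%:R <= eps * c%:R.
  have := archi_boundP (divr_ge0 (ler0n R K.+1) (ltW e0)).
  by rewrite -/c ltr_pdivrMr // mulrC => /ltW.
have c0 : (0 < c)%N.
  by case: c c1 => //; rewrite mulr0 lern0.
exists (K * (2 * c))%N, c => T h cT hK.
set n := #|T| in cT *; pose s := (n %/ c)%N.
have sn : (s * c <= n)%N by apply: leq_trunc_div.
have ns : (n < s.+1 * c)%N by rewrite ltn_ceil.
have s0 : (0 < s)%N by rewrite divn_gt0.
have ns2 : (n < s * (2 * c))%N.
  by apply: leq_trans ns _; rewrite mulSn; clear -s0; nia.
pose e x := enum (block h x).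
have ee x y : h x = h y -> e x = e y by move=> E; rewrite /e (block_eq E).
have xe x y : h x = h y -> y \in e x by move=> E; rewrite mem_enum inE E.
have se x : size (e x) = #|block h x| by rewrite cardE.
have ltn_e x : (size (e x) <= n)%N by rewrite se; apply: max_card.
pose k x := (index x (e x) %/ s)%N.
have kc x : (k x < 2 * c)%N.
  rewrite ltn_divLR //; apply: leq_ltn_trans (_ : n < _)%N; last by rewrite mulnC.
  by apply: leq_trans (ltn_e x); rewrite ltnW // index_mem xe.
pose f x := (h x * (2 * c) + k x)%N.
have fk x y : f x = f y -> h x = h y /\ k x = k y.
  move=> E; have c20 : (0 < 2 * c)%N by clear -c0; lia.
  split; [have := congr1 (fun a => a %/ (2 * c))%N E|have := congr1 (fun a => a %% (2 * c))%N E].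
    by rewrite /f !divnMDl // !divn_small ?addn0.
  by rewrite /f !modnMDl !modn_small.
exists f, s; split.
- move=> x; rewrite /f; have := hK x; have := kc x; clear; nia.
- by move=> x y /fk[].
- have full x : ((k x).+1 * s <= size (e x))%N -> #|block f x| = s.
    move=> full; rewrite (_ : block f x =
        [set z in e x | (k x * s <= index z (e x) < (k x).+1 * s)%N]).
      by rewrite card_index_range ?enum_uniq // mulSn addnK.
    apply/setP => z; rewrite !inE; apply/eqP/andP => [/fk[E1 E2]|[]].
      rewrite xe //; split => //; rewrite -(ee _ _ E1) -E2.
      by rewrite leq_trunc_div ltn_ceil.
    rewrite mem_enum inE => /eqP E /andP[l1 l2]; rewrite /f E; congr (_ + _)%N.
    rewrite {1}/k (ee _ _ E); apply/eqP; rewrite eqn_leq.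
    by rewrite [X in _ && X]leq_divRL // l1 andbT -ltnS ltn_divLR.
  have trash i : (#|[set x | #|block f x| != s & h x == i]| <= s)%N.
    have [->|[x]] := set_0Vmem [set x | #|block f x| != s & h x == i]; first by rewrite cards0.
    rewrite inE => /andP[_ /eqP hx].
    apply: leq_trans (_ : #|[set z in e x | (size (e x) - size (e x) %% s <= index z (e x)
                               < size (e x))%N]| <= _)%N; last first.
      rewrite card_index_range ?enum_uniq // subKn ?leq_mod //.
      by rewrite ltnW // ltn_mod.
    apply/subset_leq_card/subsetP => z; rewrite !inE => /andP[nf /eqP hz].
    have E : h x = h z by rewrite hx hz.
    rewrite xe // index_mem xe // andbT leqNgt; apply/negP => lt.
    case/negP: nf; apply/eqP; apply: full; rewrite /k -(ee _ _ E).
    have := divn_eq (size (e x)) s; set q := (_ %/ _)%N => Eq.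
    apply: leq_trans (_ : q * s <= _)%N; last by rewrite Eq leq_addr.
    rewrite leq_mul2r; apply/orP; right; rewrite ltn_divLR //.
    by move: lt; rewrite {1}Eq addnK.
  apply: (@le_trans _ _ (K * s)%:R).
    rewrite ler_nat -sum1_card (partition_big (fun x => Ordinal (hK x)) predT) //=.
    apply: leq_trans (_ : \sum_(i < K) s <= _)%N; last by rewrite sum_nat_const card_ord.
    apply: leq_sum => i _; rewrite sum1_card; apply: leq_trans (trash i).
    by apply/eq_leq/eq_card => x; rewrite unfold_in !inE -val_eqE.
  apply: (@le_trans _ _ (eps * c%:R * s%:R)).
    rewrite natrM ler_wpM2r //; apply: le_trans c1; by rewrite ler_nat.
  by rewrite -mulrA -natrM ler_pM2l // ler_nat mulnC.
- split=> //; have [x _] : exists x : T, x \in T.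
    by apply/card_gt0P; apply: leq_trans cT.
  have := hK x; move: ns2 => /ltnW ns2 hx; apply: leq_trans ns2 _.
  by rewrite leq_mul2l leq_pmull ?orbT // (leq_trans _ hx).
- apply: (@le_trans _ _ (eps * c%:R * s%:R)).
    rewrite -[X in X <= _]mul1r ler_wpM2r //; apply: le_trans c1; by rewrite ler1n.
  by rewrite -mulrA -natrM ler_pM2l // ler_nat mulnC.
Qed.

(** * Energy of a partition and its increment *)

Section RegularPairs.
Variables (R : realType) (T : finType).

Definition edges (g : rel T) (A B : {set T}) : R :=
  \sum_(p in setX A B) (g p.1 p.2)%:R.

Definition density (g : rel T) (A B : {set T}) : R := edges g A B / (#|A| * #|B|)%:R.

(** The deviation of the densities is multiplied out by |A| |B|. *)
Definition irregularity_witness (g : rel T) (eps : R) (Z W : {set T}) :=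
  [pred AB : {set T} * {set T} |
    [&& AB.1 \subset Z, AB.2 \subset W, eps * #|Z|%:R <= #|AB.1|%:R,
        eps * #|W|%:R <= #|AB.2|%:R &
        eps * (#|AB.1| * #|AB.2|)%:R <
          `|edges g AB.1 AB.2 - density g Z W * (#|AB.1| * #|AB.2|)%:R| ]].

Definition regular_pair (g : rel T) (eps : R) (Z W : {set T}) : bool :=
  ~~ [exists AB, irregularity_witness g eps Z W AB].

Definition pair_label (f : T -> nat) (v : T * T) := (f v.1, f v.2).

(** Pairs of vertices are counted instead of pairs of blocks, so that blocks of any size receive the
    right weight. *)
Definition irregular_pairs (g : bool -> rel T) (eps : R) (f : T -> nat) : {set T * T} :=
  [set v | [exists c, ~~ regular_pair (g c) eps (block f v.1) (block f v.2)]].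

Definition edge_ind (g : rel T) (v : T * T) : R := (g v.1 v.2)%:R.

(** The unnormalised mean-square density, summed over both colours. *)
Definition energy (g : bool -> rel T) (f : T -> nat) : R :=
  \sum_c \sum_v cexp (pair_label f) (edge_ind (g c)) v ^+ 2.

Lemma block_pair f v : block (pair_label f) v = setX (block f v.1) (block f v.2).
Proof. by apply/setP => -[x y]; rewrite !inE xpair_eqE. Qed.

Lemma cexp_density g f v :
  cexp (pair_label f) (edge_ind g) v = density g (block f v.1) (block f v.2).
Proof. by rewrite /cexp block_pair cardsX. Qed.

Lemma energy_le g f : energy g f <= 2 * #|T|%:R ^+ 2.
Proof.
rewrite /energy (_ : 2 * _ = \sum_(c : bool) #|T|%:R ^+ 2); last first.
  by rewrite big_bool /= -mulr2n mulr_natl.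
apply: ler_sum => c _; rewrite (_ : _ ^+ 2 = \sum_(v : T * T) 1); last first.
  by rewrite sumr_const card_prod natrM expr2.
apply: ler_sum => v _; have b0 := block_gt0 R (pair_label f) v.
have h : 0 <= cexp (pair_label f) (edge_ind (g c)) v <= 1.
  apply/andP; split; first by apply: divr_ge0 => //; apply: sumr_ge0 => w _; apply: ler0n.
  rewrite /cexp ler_pdivrMr // mul1r -sumr_const; apply: ler_sum => w _.
  by rewrite /edge_ind lern1 leq_b1.
by case/andP: h => h0 h1; rewrite expr_le1.
Qed.

(** By Pythagoras the gain is the sum of the squared differences. Averaged over a block pair that is
    irregular in some colour, with its witness rectangle as the deviating set, it is at least eps^4
    per vertex pair. *)
Lemma energy_increment (g : bool -> rel T) (eps : R) (f f' : T -> nat) : 0 < eps ->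
  refines f' f ->
  (forall v c, ~~ regular_pair (g c) eps (block f v.1) (block f v.2) ->
    exists AB, [/\ irregularity_witness (g c) eps (block f v.1) (block f v.2) AB,
      forall x y, f' x = f' y -> (x \in AB.1) = (y \in AB.1) &
      forall x y, f' x = f' y -> (x \in AB.2) = (y \in AB.2)]) ->
  energy g f + eps ^+ 4 * #|irregular_pairs g eps f|%:R <= energy g f'.
Proof.
move=> e0 ref wit.
have refp : refines (pair_label f') (pair_label f).
  by move=> v w [/ref E1 /ref E2]; rewrite /pair_label E1 E2.
pose dl c v := cexp (pair_label f') (edge_ind (g c)) v - cexp (pair_label f) (edge_ind (g c)) v.
have -> : energy g f' = energy g f + \sum_c \sum_v dl c v ^+ 2.
  by rewrite /energy -big_split /=; apply: eq_bigr => c _; rewrite (sum_cexp_sqr refp).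
rewrite lerD2l.
rewrite (eq_bigr (fun c => \sum_v cexp (pair_label f) (fun w => dl c w ^+ 2) v)); last first.
  by move=> c _; rewrite sum_cexp.
have ge0 c v : 0 <= cexp (pair_label f) (fun w => dl c w ^+ 2) v.
  by apply: divr_ge0 => //; apply: sumr_ge0 => w _; apply: sqr_ge0.
rewrite exchange_big /= mulr_natr -sumr_const big_mkcond /=; apply: ler_sum => v _.
case: ifP; last by move=> _; apply: sumr_ge0.
rewrite inE => /existsP[c irr]; rewrite (bigD1 c) //=.
apply: (@le_trans _ _ (cexp (pair_label f) (fun w => dl c w ^+ 2) v)); last first.
  by rewrite lerDl sumr_ge0.
have [[A B] [/and5P[/= sA sB cA cB big] mA mB]] := wit v c irr.
apply: (@cexp_delta_ge _ _ _ _ _ _ (edge_ind (g c)) (setX A B) v eps e0).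
- by rewrite block_pair; apply/subsetP => -[x y]; rewrite !inE /= => /andP[/(subsetP sA)+ /(subsetP sB)]; rewrite !inE => -> ->.
- by move=> [x y] [x' y'] [/mA E1 /mB E2]; rewrite !inE /= E1 E2.
- rewrite block_pair !cardsX !natrM.
  rewrite (_ : _ * _ = (eps * #|block f v.1|%:R) * (eps * #|block f v.2|%:R)); last by ring.
  by apply: ler_pM => //; apply: mulr_ge0 => //; apply: ltW.
- by rewrite cexp_density cardsX.
Qed.

(** The new label of x records the old one and, for each colour and pair of old labels, whether x
    lies in the two sets of a chosen witness. So the number of labels depends on [K] alone. *)
Lemma witness_refinement (g : bool -> rel T) (eps : R) (f : T -> nat) (K : nat) :
  (forall x, f x < K)%N ->
  exists h : T -> nat,
  [/\ (forall x, h x < #|{: 'I_K * {ffun bool * 'I_K * 'I_K -> bool * bool}}|)%N,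
      refines h f &
   (forall v c, ~~ regular_pair (g c) eps (block f v.1) (block f v.2) ->
    exists AB, [/\ irregularity_witness (g c) eps (block f v.1) (block f v.2) AB,
      forall x y, h x = h y -> (x \in AB.1) = (y \in AB.1) &
      forall x y, h x = h y -> (x \in AB.2) = (y \in AB.2)])].
Proof.
move=> fK; pose cl (i : 'I_K) : {set T} := [set z | f z == i].
(* Depends on the labels only, so that membership in a witness is determined by lab. *)
pose W c i j := odflt (set0, set0) [pick AB | irregularity_witness (g c) eps (cl i) (cl j) AB].
pose lab x : 'I_K * {ffun bool * 'I_K * 'I_K -> bool * bool} :=
  (Ordinal (fK x), [ffun p => (x \in (W p.1.1 p.1.2 p.2).1, x \in (W p.1.1 p.1.2 p.2).2)]).
exists (fun x => nat_of_ord (enum_rank (lab x))); split => [x|x y /val_inj/enum_rank_inj[]//|v c irr].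
  exact: ltn_ord.
have clE x : block f x = cl (Ordinal (fK x)) by [].
exists (W c (Ordinal (fK v.1)) (Ordinal (fK v.2))); split.
- rewrite /W -!clE; case: pickP => [//|none].
  by case/negP: irr; apply/existsP => -[AB]; rewrite none.
- move=> x y /val_inj/enum_rank_inj[_] /ffunP/(_ (c, Ordinal (fK v.1), Ordinal (fK v.2))).
  by rewrite !ffunE /= => -[].
- move=> x y /val_inj/enum_rank_inj[_] /ffunP/(_ (c, Ordinal (fK v.1), Ordinal (fK v.2))).
  by rewrite !ffunE /= => -[].
Qed.
End RegularPairs.

Lemma regularity (R : realType) (eps : R) : 0 < eps ->
  exists K n0 : nat, forall (T : finType) (g : bool -> rel T) (X : {set T}),
  (n0 <= #|T|)%N ->
  exists (f : T -> nat) (s : nat),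
  [/\ (forall x, f x < K)%N /\ (forall x y, f x = f y -> (x \in X) = (y \in X)),
      #|irregular_pairs g eps f|%:R <= eps * #|T|%:R ^+ 2,
      #|[set x | #|block f x| != s]|%:R <= eps * #|T|%:R,
      (0 < s)%N /\ (#|T| <= s * K)%N & s%:R <= eps * #|T|%:R].
Proof.
move=> e0.
(* A round that does not stop at a regular partition has more than eps |T|^2 irregular pairs and
   gains at least eps^5 |T|^2. The gain is computed for the equitable partition [f'] directly,
   because it refines the witnesses. *)
have iter j : exists K n0 : nat, forall (T : finType) (g : bool -> rel T) (X : {set T}),
  (n0 <= #|T|)%N ->
  exists (f : T -> nat) (s : nat),
  [/\ (forall x, f x < K)%N /\ (forall x y, f x = f y -> (x \in X) = (y \in X)),
      #|irregular_pairs g eps f|%:R <= eps * #|T|%:R ^+ 2 \/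
        j%:R * eps ^+ 5 * #|T|%:R ^+ 2 <= energy R g f,
      #|[set x | #|block f x| != s]|%:R <= eps * #|T|%:R,
      (0 < s)%N /\ (#|T| <= s * K)%N & s%:R <= eps * #|T|%:R].
  elim: j => [|j [K [n0 IH]]].
    have [K [n0 H]] := equitable_refinement 2 e0.
    exists K, n0 => T g X nT.
    have [|f [s [f1 f2 f3 f4 f5]]] := H T (fun x => (x \in X) : nat) nT.
      by move=> x; case: (x \in X).
    exists f, s; split => //.
      by split=> // x y /f2; case: (x \in X); case: (y \in X).
    right; rewrite !mul0r; apply: sumr_ge0 => c _; apply: sumr_ge0 => v _; exact: sqr_ge0.
  set K1 := #|{: 'I_K * {ffun bool * 'I_K * 'I_K -> bool * bool}}|.
  have [K2 [n2 H]] := equitable_refinement K1 e0.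
  exists (maxn K K2), (maxn n0 n2) => T g X; rewrite geq_max => /andP[nT nT2].
  have [f [s [[f1 fX] f2 f3 [s0 sK] s1]]] := IH T g X nT.
  have [reg|nreg] := boolP (#|irregular_pairs g eps f|%:R <= eps * #|T|%:R ^+ 2).
    exists f, s; split => //.
    - by split=> // x; apply: leq_trans (f1 x) (leq_maxl _ _).
    - by left.
    - by split=> //; apply: leq_trans sK _; rewrite leq_mul2l leq_maxl orbT.
  have en : j%:R * eps ^+ 5 * #|T|%:R ^+ 2 <= energy R g f.
    by case: f2 => // reg; rewrite reg in nreg.
  have [h [hK hf wit]] := witness_refinement g eps f1.
  have [f' [s' [g1 g2 g3 [g4 g4'] g5]]] := H T h nT2 hK.
  have ref : refines f' f by move=> x y /g2/hf.
  exists f', s'; split => //.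
  - split; first by move=> x; apply: leq_trans (g1 x) (leq_maxr _ _).
    by move=> x y /ref/fX.
  - right; apply: le_trans (energy_increment e0 ref _).
      rewrite -natr1 mulrDl mul1r mulrDl; apply: lerD => //.
      rewrite exprSr -mulrA ler_pM2l ?exprn_gt0 //; apply: ltW.
      by rewrite ltNge.
    move=> v c /wit[AB [w1 w2 w3]]; exists AB; split => // x y /g2; [exact: w2|exact: w3].
  - by split=> //; apply: leq_trans g4' _; rewrite leq_mul2l leq_maxr orbT.
pose j := Num.bound (2 / eps ^+ 5).
have e5 : 0 < eps ^+ 5 by rewrite exprn_gt0.
have hj : 2 < j%:R * eps ^+ 5.
  by have := archi_boundP (divr_ge0 (ler0n R 2) (ltW e5)); rewrite -/j ltr_pdivrMr.
have [K [n0 H]] := iter j.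
(* The successor makes [T] nonempty, so that j eps^5 > 2 contradicts the energy bound 2 |T|^2. *)
exists K, n0.+1 => T g X nT; have [f [s [f1 f2 f3 f4 f5]]] := H T g X (ltnW nT).
exists f, s; split => //; case: f2 => // en.
have := le_trans en (energy_le _ g f); rewrite ler_pM2r; first by rewrite leNgt hj.
by rewrite exprn_gt0 // ltr0n; apply: leq_trans nT.
Qed.

(** * The reduced graph *)

Section JoinedPairs.
Variables (R : realType) (T : finType) (g : rel T).
Implicit Types (A B Z W : {set T}) (eps dl : R).

Lemma edges_sum A B : edges R g A B = \sum_(x in A) \sum_(y in B) (g x y)%:R.
Proof.
rewrite /edges (eq_bigl (fun p => (p.1 \in A) && (p.2 \in B))); last first.
  by move=> [x y]; rewrite in_setX.
by rewrite -(pair_big (mem A) (mem B) (fun x y => (g x y)%:R)).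
Qed.

Lemma edges_nbrs A B : edges R g A B = \sum_(x in A) #|nbrs g x B|%:R.
Proof.
rewrite edges_sum; apply: eq_bigr => x _.
rewrite -sum1_card natr_sum big_mkcond [RHS]big_mkcond /=.
by apply: eq_bigr => y _; rewrite inE; case: (y \in B); case: (g x y).
Qed.

Lemma edges_sym : symmetric g -> forall A B, edges R g A B = edges R g B A.
Proof.
move=> gs A B; rewrite /edges (reindex_onto (fun p : T * T => (p.2, p.1))
  (fun p : T * T => (p.2, p.1))); last by move=> [].
apply: eq_big => [[x y]|[x y] _]; last by rewrite gs.
by rewrite !in_setX eqxx andbT andbC.
Qed.

Lemma density_sym : symmetric g -> forall Z W, density R g Z W = density R g W Z.
Proof. by move=> gs Z W; rewrite /density edges_sym // mulnC. Qed.

Lemma regular_pair_sym eps : symmetric g -> symmetric (regular_pair g eps).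
Proof.
move=> gs; have imp Z W : regular_pair g eps Z W -> regular_pair g eps W Z.
  move=> /existsP H; apply/existsP => -[[A B]] /and5P[/= h1 h2 h3 h4 h5].
  apply: H; exists (B, A); rewrite /irregularity_witness /= h1 h2 h3 h4 /=.
  by rewrite edges_sym // density_sym // mulnC.
by move=> Z W; apply/idP/idP; apply: imp.
Qed.

Lemma regular_edges_ge eps dl Z W A B : regular_pair g eps Z W -> dl <= density R g Z W ->
  A \subset Z -> B \subset W -> eps * #|Z|%:R <= #|A|%:R -> eps * #|W|%:R <= #|B|%:R ->
  (dl - eps) * (#|A| * #|B|)%:R <= edges R g A B.
Proof.
move=> /existsP reg dd sA sB cA cB.
have := ltP (eps * (#|A| * #|B|)%:R) `|edges R g A B - density R g Z W * (#|A| * #|B|)%:R|.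
case=> [lt|]; first by case: reg; exists (A, B); rewrite /irregularity_witness /= sA sB cA cB lt.
rewrite ler_norml => /andP[h _]; move: h.
have : dl * (#|A| * #|B|)%:R <= density R g Z W * (#|A| * #|B|)%:R by rewrite ler_wpM2r.
lra.
Qed.

(** Large subsets span at least the proportion dl - eps of all pairs, hence some edge. A set A of
    [ka] or more vertices of low degree would send at most 3 ka |A| edges to B, fewer than (dl -
    eps) M0 |A|. *)
Lemma regular_joined eps dl Z W (s ka M0 : nat) : regular_pair g eps Z W ->
  dl <= density R g Z W -> #|Z| = s -> #|W| = s -> 0 < eps -> eps < dl -> (0 < ka)%N ->
  eps * s%:R <= ka%:R -> (ka <= M0)%N -> 3 * ka%:R < (dl - eps) * M0%:R ->
  joined_pair g ka M0 Z W.
Proof.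
move=> reg dd cZ cW e0 ed ka0 eka kM kM3; split.
  move=> A B sA sB kA kB; apply: contrapT => nex.
  have := regular_edges_ge reg dd sA sB; rewrite cZ cW.
  move=> /(_ (le_trans eka _) (le_trans eka _)); rewrite !ler_nat => /(_ kA kB).
  rewrite {1}/edges big1; last first.
    move=> [x y]; rewrite in_setX /= => /andP[xA yB].
    by case: (boolP (g x y)) => // xy; case: nex; exists x, y.
  apply/negP; rewrite -ltNge mulr_gt0 ?subr_gt0 // ltr0n muln_gt0.
  by rewrite (leq_trans ka0 kA) (leq_trans ka0 kB).
move=> B sB MB; set A := [set x in Z | _]; rewrite ltnNge; apply/negP => kA.
have sA : A \subset Z by apply/subsetP => x; rewrite inE => /andP[].
have := regular_edges_ge reg dd sA sB; rewrite cZ cW.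
move=> /(_ (le_trans eka _) (le_trans eka _)); rewrite !ler_nat.
move=> /(_ kA (leq_trans kM MB)); apply/negP; rewrite -ltNge edges_nbrs.
have A0 : 0 < #|A|%:R :> R by rewrite ltr0n (leq_trans ka0).
apply: (@le_lt_trans _ _ (#|A|%:R * (3 * ka%:R))).
  rewrite mulr_natl -sumr_const; apply: ler_sum => x; rewrite inE => /andP[_].
  by rewrite -natrM ler_nat.
rewrite natrM [X in _ < X]mulrCA ltr_pM2l //; apply: lt_le_trans kM3 _.
by rewrite ler_pM2l ?subr_gt0 // ler_nat.
Qed.
End JoinedPairs.

Section Clusters.
Variables (T : finType) (f : T -> nat) (s : nat).

Definition clusters : {set {set T}} := [set block f x | x in [set x | #|block f x| == s]].

Lemma clusterP Z : Z \in clusters -> #|Z| = s /\ {in Z, forall x, block f x = Z}.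
Proof.
case/imsetP => x; rewrite inE => /eqP cx ->; split => // y; rewrite inE => /eqP.
exact: block_eq.
Qed.

Lemma clusters_disj Z W x : Z \in clusters -> W \in clusters -> x \in Z -> x \in W -> Z = W.
Proof. by move=> /clusterP[_ h1] /clusterP[_ h2] /h1 <- /h2. Qed.

Lemma trivIset_clusters (S : {set {set T}}) : S \subset clusters -> trivIset S.
Proof.
move=> sS; apply/trivIsetP => Z W /(subsetP sS) ZR /(subsetP sS) WR; apply: contraNT.
by case/pred0Pn => x /andP[/= xZ xW]; apply/eqP; apply: (clusters_disj ZR WR xZ xW).
Qed.

Lemma card_cover_clusters (S : {set {set T}}) : S \subset clusters ->
  #|cover S| = (#|S| * s)%N.
Proof.
move=> sS; have /eqP <- := trivIset_clusters sS.
rewrite (eq_bigr (fun=> s)); first by rewrite sum_nat_const.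
by move=> Z /(subsetP sS)/clusterP[].
Qed.

Lemma cover_clusters_in (X : {set T}) :
  (forall x y, f x = f y -> (x \in X) = (y \in X)) ->
  X :\: [set x | #|block f x| != s] \subset cover [set Z in clusters | Z \subset X].
Proof.
move=> fX; apply/subsetP => x; rewrite !inE negbK => /andP[cx xX].
apply/bigcupP; exists (block f x); last by rewrite inE.
rewrite inE imset_f ?inE //=; apply/subsetP => y; rewrite inE => /eqP/fX->.
by [].
Qed.
End Clusters.

Section ReducedGraph.
Variables (R : realType) (T : finType) (g : bool -> rel T) (f : T -> nat) (s : nat).
Variables (eps dl : R).
Hypothesis gsym : forall c, symmetric (g c).
Hypothesis s0 : (0 < s)%N.

Let cl := clusters f s.

Definition irregular Z W := [exists c, ~~ regular_pair (g c) eps Z W].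

(** The threshold [t] counts vertices: the clusters irregular with Z cover more than t of them. *)
Definition bad_clusters (t : R) : {set {set T}} :=
  [set Z in clusters f s | t < (#|[set W in clusters f s | irregular Z W]| * s)%:R].

Definition reduced (c : bool) : rel {set T} := fun Z W =>
  [&& Z \in clusters f s, W \in clusters f s, regular_pair (g c) eps Z W &
      dl <= density R (g c) Z W].

Lemma reduced_sym c : symmetric (reduced c).
Proof.
move=> Z W; rewrite /reduced regular_pair_sym // density_sym //.
by rewrite !andbA [(Z \in _) && _]andbC.
Qed.

(** Double counting: each vertex of a bad cluster lies in more than t irregular vertex pairs as
    first entry. *)
Lemma bad_clusters_card t :
  (#|bad_clusters t| * s)%:R * t <= #|irregular_pairs g eps f|%:R.
Proof.
pose I := irregular_pairs g eps f; pose gI : rel T := fun x y => (x, y) \in I.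
have sB : bad_clusters t \subset cl by apply/subsetP => Z; rewrite inE => /andP[].
rewrite -(card_cover_clusters sB) mulr_natl -sumr_const.
apply: (@le_trans _ _ (edges R gI (cover (bad_clusters t)) setT)).
  rewrite edges_nbrs; apply: ler_sum => x /bigcupP[Z]; rewrite inE => /andP[ZR tZ] xZ.
  apply: le_trans (ltW tZ) _; rewrite ler_nat.
  rewrite -(@card_cover_clusters _ f); last by apply/subsetP => W; rewrite inE => /andP[].
  apply/subset_leq_card/subsetP => y /bigcupP[W]; rewrite !inE => /andP[WR irr] yW.
  have [_ hZ] := clusterP ZR; have [_ hW] := clusterP WR.
  by rewrite /gI inE /= (hZ _ xZ) (hW _ yW).
rewrite /edges -sum1_card natr_sum [X in _ <= X]big_mkcond [X in X <= _]big_mkcond /=.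
by apply: ler_sum => -[x y] _ /=; rewrite /gI; case: ifP => _; case: ifP.
Qed.

Lemma edges_cover (c : bool) (Z : {set T}) (S : {set {set T}}) (d : R) : S \subset cl -> #|Z| = s ->
  (forall W, W \in S -> density R (g c) Z W < d) ->
  edges R (g c) Z (cover S) <= #|S|%:R * (d * s%:R ^+ 2).
Proof.
move=> sS cZ dS; have tS := trivIset_clusters sS.
rewrite edges_sum exchange_big /= big_trivIset //= mulr_natl -sumr_const.
apply: ler_sum => W WS; rewrite exchange_big /= -edges_sum.
have [cW _] := clusterP (subsetP sS _ WS).
have := dS _ WS; rewrite /density cZ cW ltr_pdivrMr ?ltr0n ?muln_gt0 ?s0 //.
by rewrite natrM expr2 => /ltW.
Qed.

(** Let S2 be the clusters in Y not joined to Z though regular with it: both densities are below dl.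
    Averaging degrees over Z gives D <= 2 dl |S2| s + (|Y| - |S2| s), and the irregular clusters
    account for at most t further vertices. *)
Lemma reduced_degree (Z X Y : {set T}) (t D : R) : 2 * dl < 1 ->
  Z \in cl -> Z \subset X -> Z \notin bad_clusters t ->
  (forall x, x \in X -> D <= #|nbrs (fun u v => g true u v || g false u v) x Y|%:R) ->
  (1 - 2 * dl) * ((#|[set W in cl | (W \subset Y) &&
      ~~ (reduced true Z W || reduced false Z W)]| * s)%:R - t) <= #|Y|%:R - D.
Proof.
move=> d0 ZR ZX Zgood degX; set S := [set W in cl | _].
pose S1 := [set W in cl | irregular Z W]; pose S2 := S :\: S1.
have sS : S \subset cl by apply/subsetP => W; rewrite inE => /andP[].
have sS2 : S2 \subset cl by apply: subset_trans (subsetDl _ _) sS.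
have hS1 : (#|S1| * s)%:R <= t by move: Zgood; rewrite inE ZR /= -leNgt.
have cS : (#|S| <= #|S1| + #|S2|)%N.
  by have := cardsID S1 S; have := subset_leq_card (subsetIr S S1); rewrite -/S2; clear; lia.
have S2Y : cover S2 \subset Y.
  apply/bigcupsP => W /setDP[+ _]; rewrite inE => /andP[_ /andP[//]].
have [cZ _] := clusterP ZR.
have dS2 c W : W \in S2 -> density R (g c) Z W < dl.
  move=> /setDP[WS]; have WR := subsetP sS _ WS.
  rewrite inE WR /= negb_exists => /forallP/(_ c); rewrite negbK => reg.
  move: WS; rewrite inE => /andP[_ /andP[_ /norP[n1 n2]]].
  rewrite ltNge; apply/negP => dd.
  have : reduced c Z W by rewrite /reduced [Z \in _]ZR [W \in _]WR reg dd.
  by case: (c); apply/negP.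
have e1 := edges_cover sS2 cZ (dS2 true); have e2 := edges_cover sS2 cZ (dS2 false).
have cC := card_cover_clusters sS2.
have nx x : x \in Z -> D <= #|nbrs (g true) x (cover S2)|%:R + #|nbrs (g false) x (cover S2)|%:R
    + (#|Y|%:R - (#|S2| * s)%:R).
  move=> /(subsetP ZX)/degX/le_trans; apply.
  rewrite -natrD -natrB; last by rewrite -cC subset_leq_card.
  rewrite -natrD ler_nat -cC.
  set e := fun u v => _.
  have -> : (#|Y| - #|cover S2| = #|Y :\: cover S2|)%N.
    by rewrite cardsD (setIidPr S2Y).
  have [l1 _] := leq_card_setU (nbrs (g true) x (cover S2)) (nbrs (g false) x (cover S2)).
  have [l2 _] := leq_card_setU (nbrs (g true) x (cover S2) :|: nbrs (g false) x (cover S2))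
     (Y :\: cover S2).
  apply: leq_trans (leq_trans l2 _); last by rewrite leq_add2r.
  apply/subset_leq_card/subsetP => y; rewrite 2!inE => /andP[yY xy].
  by rewrite !inE yY; case: (y \in cover S2) => //=; rewrite orbF -/(e x y).
have : \sum_(x in Z) D <= \sum_(x in Z) (#|nbrs (g true) x (cover S2)|%:R +
    #|nbrs (g false) x (cover S2)|%:R + (#|Y|%:R - (#|S2| * s)%:R)).
  exact: ler_sum.
rewrite !big_split /= -!edges_nbrs !sumr_const cZ => h.
have {h} h : s%:R * D <= 2 * (#|S2|%:R * (dl * s%:R ^+ 2)) + s%:R * (#|Y|%:R - (#|S2| * s)%:R).
  by move: h e1 e2; rewrite !mulr_natl; lra.
have {h} : s%:R * D <= s%:R * (2 * dl * (#|S2| * s)%:R + (#|Y|%:R - (#|S2| * s)%:R)).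
  by apply: le_trans h _; rewrite natrM le_eqVlt; apply/orP; left; apply/eqP; ring.
rewrite ler_pM2l ?ltr0n // => h.
have cS' : (#|S| * s)%:R <= (#|S1| * s)%:R + (#|S2| * s)%:R :> R.
  by rewrite -natrD ler_nat -mulnDl leq_mul2r cS orbT.
have : (1 - 2 * dl) * ((#|S| * s)%:R - t) <= (1 - 2 * dl) * (#|S2| * s)%:R.
  by rewrite ler_pM2l; lra.
lra.
Qed.
End ReducedGraph.

(** * From connected matchings to cycles of one colour *)

Definition color_rel (T : finType) (e : rel T) (col : T -> T -> bool) (c : bool) : rel T :=
  fun x y => e x y && (col x y == c).

Lemma colored_cycles_of_matching (R : realType) (T : finType) (e : rel T)
    (col : T -> T -> bool) (f : T -> nat) (s : nat) (eps dl : R) (c : bool)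
    (K p ka M0 c0 : nat) :
  simple_graph e -> edge_coloring e col -> 0 < eps -> eps < dl ->
  (#|clusters f s| <= K)%N -> (p <= K)%N -> (0 < p)%N ->
  (0 < ka)%N -> eps * s%:R <= ka%:R -> (ka <= M0)%N -> 3 * ka%:R < (dl - eps) * M0%:R ->
  (c0 + 2 * (K * K) + M0 + 2 * ka < s)%N ->
  connected_matching (reduced (color_rel e col) f s eps dl c) p ->
  forall l, ~~ odd l -> (4 <= l)%N -> (l <= 2 * (p * c0))%N -> colored_cycle e col c l.
Proof.
move=> [es ei] ec e0 ed cK pK p0 ka0 eka kM kM3 hs cm l ol l4 lp.
have gsym c' : symmetric (color_rel e col c').
  move=> x y; rewrite /color_rel es; have [yx|//] := boolP (e y x).
  by rewrite (ec _ _ yx).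
have girr : irreflexive (color_rel e col c) by move=> x; rewrite /color_rel ei.
have rsym := reduced_sym f s eps dl gsym c.
have rsub u v : reduced (color_rel e col) f s eps dl c u v -> v \in clusters f s.
  by case/and4P.
have h1 : (c0 + 2 * (p * #|clusters f s|) <= c0 + 2 * (K * K))%N.
  by rewrite leq_add2l leq_mul2l /= leq_mul.
have [z [w [w1 w2 w3 w4]]] := closed_walk_even rsym rsub cm p0 h1 ol lp.
have [||||cyc [s1 s2 s3]] := @embed_closed_walk _ (color_rel e col c) (clusters f s) _
   ka M0 s _ z w ka0 (gsym c) girr rsym _ _ _ hs w1 w2 _ w4.
- by move=> Z W x; apply: clusters_disj.
- by move=> Z /clusterP[].
- move=> Z W /and4P[ZR WR reg dd]; split => //.
  have [cZ _] := clusterP ZR; have [cW _] := clusterP WR.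
  exact: (regular_joined reg dd cZ cW).
- by rewrite w3; clear -l4; lia.
by rewrite -w3 -s1; apply: colored_cycle_of_cycle.
Qed.

(** * Choice of constants and numerical estimates *)

Lemma embedding_constants (R : realType) (dl eps : R) (K s : nat) :
  0 < dl -> dl <= 1 / 100 -> eps = dl ^+ 2 / 100 -> 10 + 4 * (K * K)%:R <= dl ^+ 2 * s%:R ->
  exists ka M0 c0 : nat,
  [/\ (0 < ka)%N /\ eps * s%:R <= ka%:R, (ka <= M0)%N, 3 * ka%:R < (dl - eps) * M0%:R,
      (c0 + 2 * (K * K) + M0 + 2 * ka < s)%N & (1 - 2 * dl) * s%:R <= c0%:R].
Proof.
move=> d0 d1 -> hs; set eps' := dl ^+ 2 / 100.
have kk0 : 0 <= (K * K)%:R :> R by apply: ler0n.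
have sR : 0 <= s%:R :> R by apply: ler0n.
have k0 : 0 <= eps' * s%:R by apply: mulr_ge0 => //; rewrite divr_ge0 // exprn_ge0 // ltW.
have m0 : 0 <= dl * s%:R by apply: mulr_ge0 => //; apply: ltW.
have /andP[k1 k2] := truncn_itv k0; have /andP[m1 m2] := truncn_itv m0.
set k := Num.truncn (eps' * s%:R) in k1 k2; set M0 := Num.truncn (dl * s%:R) in m1 m2.
rewrite -natr1 in k2; rewrite -natr1 in m2.
have ds : dl ^+ 2 * s%:R <= dl / 100 * s%:R.
  by rewrite ler_wpM2r // expr2; apply: ler_pM => //; [apply: ltW|apply: ltW|lra].
have ek : eps' * s%:R = dl ^+ 2 * s%:R / 100 by rewrite /eps'; field.
have kM : (k.+1 <= M0)%N by rewrite -(ler_nat R) -natr1; lra.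
have big : (0 + 2 * (K * K) + M0 + 2 * k.+1 < s)%N.
  rewrite -(ltr_nat R) !natrD !natrM -!natr1.
  have : dl * s%:R <= s%:R / 100 by rewrite mulrC ler_wpM2l //; lra.
  by rewrite natrM in hs kk0; lra.
(* [ka] is just above eps s, [M0] is dl s rounded down, and [c0] is all that the strict inequality
   leaves; the total loss is below 2 dl s. *)
exists k.+1, M0, (s - (2 * (K * K) + M0 + 2 * k.+1).+1)%N; split => //.
- by split=> //; rewrite -natr1; lra.
- rewrite -natr1.
  have h1 : (dl - eps') * (dl * s%:R - 1) <= (dl - eps') * M0%:R.
    rewrite ler_wpM2l //; last by lra.
    by rewrite subr_ge0 /eps' expr2 -mulrA; nra.
  apply: lt_le_trans h1.
  have -> : (dl - eps') * (dl * s%:R - 1) = dl ^+ 2 * s%:R - eps' * s%:R * dl - dl + eps'.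
    by ring.
  have : eps' * s%:R * dl <= eps' * s%:R * 1 by rewrite ler_wpM2l //; lra.
  have : 0 <= eps' by rewrite divr_ge0 // exprn_ge0 // ltW.
  lra.
- by clear -big; lia.
- rewrite natrB; last by clear -big; lia.
  have -> : (2 * (K * K) + M0 + 2 * k.+1).+1%:R =
      2 * (K * K)%:R + M0%:R + 2 * (k%:R + 1) + 1 :> R.
    by rewrite -[X in X = _]natr1 !natrD [(2 * k.+1)%:R]natrM -[k.+1%:R]natr1 !natrM; ring.
  have := ds; lra.
Qed.

(** q is L a2 / c0 rounded down, plus one. It is at most m / 2 because a2 < 1 / 2, and the 2 in m -
    2 pays for the rounding in both estimates. *)
Lemma split_matching_size (R : realType) (a1 a2 L : R) (m c0 : nat) :
  a1 > a2 -> a2 > 0 -> a1 + a2 = 1 -> 0 < L -> (0 < c0)%N -> L <= (m%:R - 2) * c0%:R ->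
  exists q, [/\ (0 < q)%N, (2 * q <= m)%N, L * a2 <= q%:R * c0%:R &
     L * a1 <= (m - q)%:R * c0%:R].
Proof.
move=> a12 a20 a1a2 L0 c00 hL.
have c0R : 0 < c0%:R :> R by rewrite ltr0n.
have z0 : 0 <= L * a2 / c0%:R by rewrite divr_ge0 // mulr_ge0 // ltW.
have /andP[t1 t2] := truncn_itv z0; set t := Num.truncn _ in t1 t2.
rewrite ler_pdivlMr // in t1; rewrite ltr_pdivrMr // -natr1 in t2.
have La : L * a2 < L * (1 / 2) by rewrite ltr_pM2l //; lra.
have q2 : (2 * t.+1 <= m)%N.
  rewrite -(ler_nat R) natrM -natr1.
  have : t%:R * c0%:R < (m%:R - 2) / 2 * c0%:R :> R by lra.
  by rewrite ltr_pM2r //; lra.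
exists t.+1; split => //; first by rewrite -natr1; lra.
rewrite natrB; last by clear -q2; lia.
rewrite -natr1.
have : L * a1 + L * a2 = L by rewrite -mulrDr a1a2 mulr1.
lra.
Qed.

Lemma bipartite_with_sym (T : finType) (e : rel T) (X Y : {set T}) :
  bipartite_with e X Y -> bipartite_with e Y X.
Proof.
case=> dXY XY eXY; split; [by rewrite disjoint_sym|by rewrite setUC|].
by move=> u v /eXY; rewrite orbC.
Qed.

Lemma deg_nbrs (T : finType) (e : rel T) (X Y : {set T}) v :
  bipartite_with e X Y -> v \in X -> deg e v = #|nbrs e v Y|.
Proof.
case=> dXY _ eXY vX; apply: eq_card => u; rewrite !inE.
apply/idP/andP => [vu|[]//]; split => //.
by have := eXY _ _ vu; rewrite vX (disjointFr dXY vX) orbF.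
Qed.

(** Otherwise the left side would be at least (1 / 4 - 2 dl) n, above the right side (1 / 4 - 3 eta)
    n. *)
Lemma few_missing (R : realType) (eta dl n x : R) : 0 < n -> 0 < dl -> dl <= eta / 100 ->
  eta <= 1 / 12 ->
  (1 - 2 * dl) * (x - dl * n) <= n - (3 / 4 + 3 * eta) * n -> 4 * x < (1 - 2 * dl) * n.
Proof.
move=> n0 d0 de e1 h; rewrite ltNge; apply/negP => hx.
have : (1 - 2 * dl) * ((1 - 2 * dl) * n / 4 - dl * n) <= (1 - 2 * dl) * (x - dl * n).
  by rewrite ler_pM2l; lra.
move=> /le_trans/(_ h).
have -> : (1 - 2 * dl) * ((1 - 2 * dl) * n / 4 - dl * n) = (1 - 8 * dl + 12 * dl ^+ 2) / 4 * n.
  by field.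
have -> : n - (3 / 4 + 3 * eta) * n = (1 / 4 - 3 * eta) * n by field.
by rewrite ler_pM2r //; have := sqr_ge0 dl; lra.
Qed.

(** Since 2 s <= dl n, the right side is at least (1 - 2 dl)(1 - 3 dl) n, a loss of about 5 dl n,
    whereas the left side gives up 150 dl n because eta^2 = 100 dl. *)
Lemma enough_clusters (R : realType) (eta dl eps n m s c0 : R) :
  0 < eta -> eta <= 1 / 12 -> dl = eta ^+ 2 / 100 -> eps = dl ^+ 2 / 100 -> 1 <= dl * n ->
  0 < n -> 0 < s -> (1 - 2 * dl) * n <= m * s -> s <= eps * (2 * n) -> (1 - 2 * dl) * s <= c0 ->
  (1 - 3 / 2 * eta ^+ 2) * (n + 1) <= (m - 2) * c0.
Proof.
move=> e0 e1 Ed Ee dn n0 s0 ms se hc.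
have d0 : 0 < dl by rewrite Ed divr_gt0 // exprn_gt0.
have d1 : dl <= 1 / 1000.
  have : eta ^+ 2 <= 1 / 12 * (1 / 12) by rewrite expr2; apply: ler_pM => //; apply: ltW.
  by rewrite Ed; lra.
have dd : dl ^+ 2 * n <= dl * n / 1000.
  by rewrite expr2 -mulrA [X in _ <= X]mulrC ler_pM2r ?mulr_gt0 //; lra.
have se' : 2 * s <= dl * n by move: se; rewrite Ee mulrAC -!mulrA; lra.
have dln : dl * n <= 1 / 1000 * n by rewrite ler_pM2r.
have m2 : 0 <= m - 2.
  have : 0 <= (m - 2) * s by lra.
  by rewrite pmulr_lge0.
have h1 : (m - 2) * ((1 - 2 * dl) * s) <= (m - 2) * c0 by rewrite ler_wpM2l.
apply: le_trans h1.
have h2 : (1 - 2 * dl) * ((1 - 3 * dl) * n) <= (m - 2) * ((1 - 2 * dl) * s).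
  by rewrite [X in _ <= X]mulrCA ler_pM2l; lra.
apply: le_trans h2.
have -> : eta ^+ 2 = 100 * dl by rewrite Ed; field.
have -> : (1 - 2 * dl) * ((1 - 3 * dl) * n) = n - 5 * (dl * n) + 6 * (dl ^+ 2 * n) by ring.
have : 0 <= dl ^+ 2 * n by rewrite mulr_ge0 ?sqr_ge0 // ltW.
lra.
Qed.

Theorem theorem1p6 (R : realType) (eta : R) : 0 < eta ->
  exists N0 : nat, (0 < N0)%N /\
  forall N : nat, (N0 < N)%N ->
  forall (a1 a2 : R), a1 > a2 -> a2 > 0 -> a1 + a2 = 1 ->
  forall (T : finType) (e : rel T) (X Y : {set T}),
    simple_graph e -> bipartite_with e X Y ->
    #|X| = N.-1 -> #|Y| = N.-1 ->
    (forall v : T, (3 / 4 + 3 * eta) * (N.-1)%:R <= (deg e v)%:R) ->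
  forall col : T -> T -> bool, edge_coloring e col ->
    (forall l : nat, ~~ odd l -> (4 <= l)%N ->
        l%:R <= (2 - 3 * eta ^+ 2) * a1 * N%:R -> colored_cycle e col true l)
 \/ (forall l : nat, ~~ odd l -> (4 <= l)%N ->
        l%:R <= (2 - 3 * eta ^+ 2) * a2 * N%:R -> colored_cycle e col false l).
Proof.
move=> eta0.
(* For eta > 1 / 12 the required degree exceeds the size of the other side, so no such graph
   exists. *)
have [big|eta1] := ltP (1 / 12) eta.
  exists 1%N; split => // N N1 a1 a2 _ _ _ T e X Y _ bip cX cY degT col _; exfalso.
  have n0 : (0 < N.-1)%N by clear -N1; lia.
  have [v vX] : exists v, v \in X by apply/card_gt0P; rewrite cX.
  have := degT v; rewrite (deg_nbrs bip vX); apply/negP; rewrite -ltNge.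
  apply: (@le_lt_trans _ _ (1 * N.-1%:R)).
    rewrite mul1r ler_nat -cY; apply/subset_leq_card/subsetP => u.
    by rewrite inE => /andP[].
  by rewrite ltr_pM2r ?ltr0n //; lra.
pose dl := eta ^+ 2 / 100; pose eps := dl ^+ 2 / 100.
have d0 : 0 < dl by rewrite divr_gt0 // exprn_gt0.
have e0 : 0 < eps by rewrite divr_gt0 // exprn_gt0.
have deta : dl <= eta / 100.
  by rewrite /dl ler_pM2r ?invr_gt0 ?ltr0n // expr2 ger_pMr //; lra.
have d1 : dl <= 1 / 100 by lra.
have ed : eps <= dl / 100.
  by rewrite /eps ler_pM2r ?invr_gt0 ?ltr0n // expr2 ger_pMr //; lra.
have [K [n1 Hreg]] := regularity e0.
pose b1 := Num.bound ((10 + 4 * (K * K)%:R) / dl ^+ 2).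
pose b2 := Num.bound (1 / dl).
(* [n1] makes regularity applicable, [K * b1] forces clusters of size s >= b1 because 2 n <= s K,
   and [b2] gives 1 <= dl n. *)
exists (n1 + K * b1 + b2).+1; split => //.
move=> N NN0 a1 a2 a12 a20 a1a2 T e X Y sg bip cX cY degT col ec.
set n := N.-1 in cX cY degT.
have nbig : (n1 + K * b1 + b2 < n)%N by rewrite /n; clear -NN0; lia.
have EN : N%:R = n%:R + 1 :> R by rewrite natr1 /n prednK //; clear -NN0; lia.
have n0 : (0 < n)%N by clear -nbig; lia.
have nR : 0 < n%:R :> R by rewrite ltr0n.
have dn : 1 <= dl * n%:R.
  have := archi_boundP (divr_ge0 ler01 (ltW d0)); rewrite -/b2 ltr_pdivrMr // mulrC.
  move=> /ltW/le_trans; apply; rewrite ler_pM2l // ler_nat; clear -nbig; lia.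
have [dXY XY _] := bip.
have cT : #|T| = (2 * n)%N.
  rewrite -cardsT -XY cardsU (disjoint_setI0 dXY) cards0 cX cY; clear; lia.
have n1T : (n1 <= #|T|)%N by rewrite cT; clear -nbig; lia.
pose g := color_rel e col.
have gsym c : symmetric (g c).
  case: sg => es _ x y; rewrite /g /color_rel es; have [yx|//] := boolP (e y x).
  by rewrite (ec _ _ yx).
have [f [s [[fK fX] irrs trash [s0 sK] seps]]] := Hreg T g X n1T.
have inY y : (y \in Y) = (y \notin X).
  have : y \in X :|: Y by rewrite XY inE.
  by rewrite inE; case: (boolP (y \in X)) => [/(disjointFr dXY)->//|_ /= ->].
have fY x y : f x = f y -> (x \in Y) = (y \in Y) by rewrite !inY => /fX->.
pose cl := clusters f s.
have clK : (#|cl| <= K)%N.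
  rewrite -(leq_pmul2r s0) -(card_cover_clusters (subxx cl)) [(K * s)%N]mulnC.
  exact: leq_trans (max_card _) sK.
have sbig : 10 + 4 * (K * K)%:R <= dl ^+ 2 * s%:R.
  have b1s : (b1 <= s)%N.
    rewrite leqNgt; apply/negP => lt.
    have : (s * K <= K * b1)%N by rewrite mulnC leq_mul2l ltnW ?orbT.
    by move: sK; rewrite cT; clear -nbig; lia.
  have dd0 : 0 < dl ^+ 2 by rewrite exprn_gt0.
  have z0 : 0 <= (10 + 4 * (K * K)%:R) / dl ^+ 2.
    by rewrite divr_ge0 ?(ltW dd0) // addr_ge0 // mulr_ge0.
  have := archi_boundP z0; rewrite -/b1 ltr_pdivrMr // [_ * dl ^+ 2]mulrC => /ltW/le_trans; apply.
  by rewrite ler_pM2l // ler_nat.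
have [ka [M0 [c0 [[ka0 eka] kM kM3 hs hc0]]]] := embedding_constants d0 d1 (erefl eps) sbig.
have sR : 0 < s%:R :> R by rewrite ltr0n.
have c0R : 0 < c0%:R :> R by apply: lt_le_trans hc0; rewrite mulr_gt0 //; lra.
have c00 : (0 < c0)%N by rewrite -(ltr0n R).
pose bad := bad_clusters g f s eps (dl * n%:R).
(* The irregular pairs number at most eps (2 n)^2 = dl^2 n^2 / 25, and the threshold is dl n. *)
have badn : (#|bad| * s)%:R <= dl * n%:R / 25.
  have dn0 : 0 < dl * n%:R by rewrite mulr_gt0.
  rewrite -(ler_pM2r dn0); apply: le_trans (le_trans (bad_clusters_card _ _ _ _ _) irrs) _.
  by rewrite cT natrM /eps le_eqVlt; apply/orP; left; apply/eqP; field.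
have good (X' : {set T}) : (forall x y, f x = f y -> (x \in X') = (y \in X')) -> #|X'| = n ->
    (1 - 2 * dl) * n%:R <= (#|[set Z in cl | Z \subset X'] :\: bad| * s)%:R.
  move=> fX' cX'; set RX := [set Z in cl | _].
  have sRX : RX \subset cl by apply/subsetP => Z; rewrite inE => /andP[].
  have := subset_leq_card (cover_clusters_in s fX'); rewrite -/cl -/RX (card_cover_clusters sRX).
  set tr := [set x | _] in trash *.
  have h1 := cardsD X' tr; have h2 := subset_leq_card (subsetIr X' tr).
  have h3 : (#|RX| <= #|RX :\: bad| + #|bad|)%N by apply: cardD_le.
  move=> h4; have h5 : (n <= #|RX| * s + #|tr|)%N by clear -h1 h2 h4 cX'; lia.
  have h6 : (n <= #|RX :\: bad| * s + #|bad| * s + #|tr|)%N.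
    by apply: leq_trans h5 _; rewrite leq_add2r -mulnDl leq_mul2r h3 orbT.
  move: h6; rewrite -(ler_nat R) !natrD; move: trash; rewrite cT natrM.
  have : eps * (2 * n%:R) <= dl * n%:R / 50.
    by rewrite mulrCA -mulrA mulrC -mulrA; have := ler_wpM2r (ltW nR) ed; lra.
  by lra.
have goodX := good X fX cX; have goodY := good Y fY cY.
set GX := _ :\: bad in goodX; set GY := _ :\: bad in goodY.
(* Both sides are trimmed to the same number m of good clusters. *)
pose m := minn #|GX| #|GY|.
have [A AX cA] := exists_subset_card (geq_minl #|GX| #|GY|).
have [B BY cB] := exists_subset_card (geq_minr #|GX| #|GY|).
rewrite -/m in cA cB.
have ms : (1 - 2 * dl) * n%:R <= (m * s)%:R.
  by rewrite /m; case: (leqP #|GX| #|GY|).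
have GXP Z : Z \in GX -> [/\ Z \in cl, Z \subset X & Z \notin bad].
  by rewrite !in_setD inE => /andP[-> /andP[-> ->]].
have GYP Z : Z \in GY -> [/\ Z \in cl, Z \subset Y & Z \notin bad].
  by rewrite !in_setD inE => /andP[-> /andP[-> ->]].
have dAB : [disjoint A & B].
  rewrite -setI_eq0; apply/eqP/setP => Z; rewrite !inE; apply/negP => /andP[ZA ZB].
  have [Zcl ZX _] := GXP _ (subsetP AX _ ZA); have [_ ZY _] := GYP _ (subsetP BY _ ZB).
  have [cZ _] := clusterP Zcl.
  have : (0 < #|Z|)%N by rewrite cZ.
  case/card_gt0P => z zZ; have := subsetP ZY _ zZ.
  by rewrite inY (subsetP ZX).
have mK : (m <= K)%N.
  by rewrite -cA; apply: leq_trans clK; apply/subset_leq_card/subsetP => Z /(subsetP AX)/GXP[].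
pose rho c := reduced g f s eps dl c.
have rsym c : symmetric (rho c) := reduced_sym f s eps dl gsym c.
have deg_col (X' Y' : {set T}) : bipartite_with e X' Y' -> forall x, x \in X' ->
    (3 / 4 + 3 * eta) * n%:R <= #|nbrs (fun u v => g true u v || g false u v) x Y'|%:R.
  move=> bip' x xX'; apply: le_trans (degT x) _; rewrite (deg_nbrs bip' xX') ler_nat.
  apply/subset_leq_card/subsetP => y; rewrite !inE /g /color_rel => /andP[-> ->] /=.
  by case: (col x y).
have miss (X' Y' Z : {set T}) (S : {set {set T}}) : bipartite_with e X' Y' -> #|Y'| = n ->
    Z \in cl -> Z \subset X' -> Z \notin bad ->
    (forall W, W \in S -> [/\ W \in cl, W \subset Y' & ~~ (rho true Z W || rho false Z W)]) ->
    (4 * #|S| < m)%N.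
  move=> bip' cY' Zcl ZX Zg SP; have d2 : 2 * dl < 1 by lra.
  have := reduced_degree s0 d2 Zcl ZX Zg (deg_col _ _ bip').
  rewrite cY' => /(few_missing nR d0 deta eta1) lt.
  rewrite -(ltn_pmul2r s0) -(ltr_nat R); apply: lt_le_trans ms; apply: le_lt_trans lt.
  rewrite -[4]/(4%:R) -natrM ler_nat -mulnA leq_mul2l /= leq_mul2r; apply/orP; right.
  apply/subset_leq_card/subsetP => W /SP[Wcl WY nW].
  by rewrite inE [W \in _]Wcl WY nW.
have missA Z : Z \in A -> (4 * #|[set W in B | ~~ (rho true Z W || rho false Z W)]| < m)%N.
  move=> ZA; have [Zcl ZX Zg] := GXP _ (subsetP AX _ ZA).
  apply: (miss X Y Z) => // W; rewrite inE => /andP[WB nW].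
  by have [Wcl WY _] := GYP _ (subsetP BY _ WB).
have missB W : W \in B -> (4 * #|[set Z in A | ~~ (rho true Z W || rho false Z W)]| < m)%N.
  move=> WB; have [Wcl WY Wg] := GYP _ (subsetP BY _ WB).
  apply: (miss Y X W) => //; first exact: bipartite_with_sym.
  move=> Z; rewrite inE => /andP[ZA nZ]; have [Zcl ZX _] := GXP _ (subsetP AX _ ZA).
  by rewrite rsym [rho false W Z]rsym.
(* Half of [(2 - 3 * eta ^+ 2) * N], because a connected matching of size p yields even lengths up
   to [2 * (p * c0)]. *)
pose L := (1 - 3 / 2 * eta ^+ 2) * N%:R.
have L0 : 0 < L.
  rewrite /L mulr_gt0 ?EN //; last by lra.
  have : eta ^+ 2 <= 1 / 12 * (1 / 12) by rewrite expr2; apply: ler_pM => //; apply: ltW.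
  by lra.
have hL : L <= (m%:R - 2) * c0%:R.
  rewrite /L EN; apply: (@enough_clusters _ eta dl eps n%:R m%:R s%:R) => //.
    by rewrite -natrM.
  by move: seps; rewrite cT natrM.
have [q [q0 q2 La2 La1]] := split_matching_size a12 a20 a1a2 L0 c00 hL.
have cyc c p a : (0 < p)%N -> (p <= K)%N -> L * a <= p%:R * c0%:R ->
    connected_matching (rho c) p ->
    forall l, ~~ odd l -> (4 <= l)%N -> l%:R <= (2 - 3 * eta ^+ 2) * a * N%:R ->
    colored_cycle e col c l.
  move=> p0 pK La cm l ol l4 ll.
  have ed' : eps < dl by lra.
  apply: (colored_cycles_of_matching sg ec e0 ed' clK pK p0 ka0 eka kM kM3 hs cm ol l4).
  rewrite -(ler_nat R); apply: le_trans ll _; rewrite natrM natrM.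
  have -> : (2 - 3 * eta ^+ 2) * a * N%:R = 2 * (L * a) by rewrite /L; field.
  by rewrite ler_pM2l.
have [cm|cm] := connected_matching_two_colors dAB (rsym true) (rsym false) cA cB missA missB q2.
  by left; apply: cyc cm => //; clear -q0 q2 mK; lia.
by right; apply: cyc cm => //; clear -q0 q2 mK; lia.
Qed.
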